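(* In the case of Affine Kriging, with a Matérn kernel with smoothness $\nu\in(1,2)$, the reference prior $\pi(\theta)$ is $O(\theta^{-2(2-\nu)-1})$ when $\theta\to+\infty$. It is a proper prior distribution, i.e. $\int_0^{+\infty}\pi(\theta)\,d\theta<+\infty$. Furthermore, for every $\boldsymbol y\in\mathbb R^n$ such that $\boldsymbol W^\top\boldsymbol y$ is non-null, the likelihood function $L_{\boldsymbol y}(\theta)$ converges to a non-null constant when $\theta\to+\infty$.
   Context: Let $r\ge1$ and let $\boldsymbol x^{(1)},\dots,\boldsymbol x^{(n)}\in\mathbb R^r$ be distinct fixed points. The Matérn kernel with smoothness $\nu>0$ is $K(0)=1$, $K(t)=\Gamma(\nu)^{-1}2^{1-\nu}(2\sqrt\nu\,t)^\nu\mathcal K_\nu(2\sqrt\nu\,t)$ for $t>0$, with $\mathcal K_\nu$ the modified Bessel function of the second kind. For $\theta>0$, $\boldsymbol\Sigma_\theta$ is the $n\times n$ (positive definite) matrix with $(i,i')$-th element $K(\|\boldsymbol x^{(i)}-\boldsymbol x^{(i')}\|/\theta)$. Affine Kriging: $p=r+1$, $n>p$, and $\boldsymbol H$ is the $n\times(r+1)$ matrix whose first column is the vector of ones $\boldsymbol 1$ and whose last $r$ columns contain the coordinates of the design points (row $i$ is $(1,(\boldsymbol x^{(i)})^\top)$); $\boldsymbol H$ is assumed to have rank $p=r+1$. $\boldsymbol W$ is a fixed $n\times(n-p)$ matrix with $\boldsymbol W^\top\boldsymbol W=\boldsymbol I_{n-p}$ and $\boldsymbol H^\top\boldsymbol W=\boldsymbol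 0$. Put $\boldsymbol\Sigma^{\boldsymbol W}_\theta=\boldsymbol W^\top\boldsymbol\Sigma_\theta\boldsymbol W$. The reference prior on $\theta$ is, up to a positive multiplicative constant, $$\pi(\theta)=\sqrt{\operatorname{Tr}\Big[\Big\{\big(\tfrac{d}{d\theta}\boldsymbol\Sigma^{\boldsymbol W}_\theta\big)(\boldsymbol\Sigma^{\boldsymbol W}_\theta)^{-1}\Big\}^2\Big]-\frac1{n-p}\Big[\operatorname{Tr}\Big\{\big(\tfrac{d}{d\theta}\boldsymbol\Sigma^{\boldsymbol W}_\theta\big)(\boldsymbol\Sigma^{\boldsymbol W}_\theta)^{-1}\Big\}\Big]^2}.$$ The (integrated) likelihood is $L_{\boldsymbol y}(\theta)=\int_0^\infty\int_{\mathbb R^p}(2\pi\sigma^2)^{-n/2}|\boldsymbol\Sigma_\theta|^{-1/2}\exp\{-\frac1{2\sigma^2}(\boldsymbol y-\boldsymbol H\boldsymbol\beta)^\top\boldsymbol\Sigma_\theta^{-1}(\boldsymbol y-\boldsymbol H\boldsymbol\beta)\}\,d\boldsymbol\beta\,\frac{d\sigma^2}{\sigma^2}$, which equals, up to a positive constant not depending on $\theta$, $|\boldsymbol W^\top\boldsymbol\Sigma_\theta\boldsymbol W|^{-1/2}\big(\boldsymbol y^\top\boldsymbol W(\boldsymbol W^\top\boldsymbol\Sigma_\theta\boldsymbol W)^{-1}\boldsymbol W^\top\boldsymbol y\big)^{-(n-p)/2}$. *)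

(* Defs.v *)
From mathcomp Require Export all_boot all_order all_algebra.
From mathcomp Require Export all_classical all_reals all_analysis.
Export Order.TTheory GRing.Theory Num.Theory.
Export numFieldNormedType.Exports.

Set Implicit Arguments.
Unset Strict Implicit.
Unset Printing Implicit Defensive.

#[export] Set Implicit Arguments.
#[export] Unset Strict Implicit.
#[export] Unset Printing Implicit Defensive.

Local Open Scope classical_set_scope.
Local Open Scope ring_scope.

(* Lets the Landau notation [f =O_ +oo_R g] be used. *)
Canonical pinfty_filter_on (R : numFieldType) :=
  FilterType (pinfty_nbhs R) _.

(* Euler's integral; meaningful for 0 < a. *)
Definition Gamma (R : realType) (a : R) : R :=
  (\int[lebesgue_measure]_(t in `]0%R, +oo[) (t `^ (a - 1) * expR (- t)))%R.

(* K_nu(z) = int_0^oo exp(- z cosh t) cosh(nu t) dt  for z > 0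
   (DLMF 10.32.9), valid for every real order nu. *)
Definition cosh (R : realType) (t : R) : R := (expR t + expR (- t)) / 2.

Definition besselK (R : realType) (nu z : R) : R :=
  (\int[lebesgue_measure]_(t in `]0%R, +oo[)
     (expR (- (z * cosh t)) * cosh (nu * t)))%R.

Definition matern (R : realType) (nu t : R) : R :=
  if t == 0 then 1
  else (Gamma nu)^-1 * 2 `^ (1 - nu) * (2 * Num.sqrt nu * t) `^ nu
       * besselK nu (2 * Num.sqrt nu * t).

(* The Euclidean norm: the library's `|v| on matrices is the sup norm. *)
Definition norm2 (R : realType) (r : nat) (v : 'rV[R]_r) : R :=
  Num.sqrt (\sum_(k < r) v 0 k ^+ 2).

Definition Sigma (R : realType) (n r : nat) (nu : R)
    (x : 'I_n -> 'rV[R]_r) (theta : R) : 'M[R]_n :=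
  \matrix_(i, j) matern nu (norm2 (x i - x j) / theta).

Definition affine_design (R : realType) (n r : nat) (x : 'I_n -> 'rV[R]_r) :
    'M[R]_(n, r.+1) :=
  row_mx (const_mx 1 : 'cV[R]_n) (\matrix_i x i).

Definition SigmaW (R : realType) (n r m : nat) (nu : R)
    (x : 'I_n -> 'rV[R]_r) (W : 'M[R]_(n, m)) (theta : R) : 'M[R]_m :=
  W^T *m Sigma nu x theta *m W.

(* The representative, with multiplicative constant 1, of the reference prior;
   m is n - p, the number of columns of W. *)
Definition reference_prior (R : realType) (n r m : nat) (nu : R)
    (x : 'I_n -> 'rV[R]_r) (W : 'M[R]_(n, m)) (theta : R) : R :=
  let A := derive1 (SigmaW nu x W) theta *m invmx (SigmaW nu x W theta) in
  Num.sqrt (\tr (A *m A) - (m%:R)^-1 * (\tr A) ^+ 2).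

(* The Lebesgue integral over R^p of a nonnegative measurable function, as the
   iterated integral over its p coordinates (Tonelli). *)
Fixpoint integral_cV (R : realType) (p : nat) : ('cV[R]_p -> \bar R) -> \bar R :=
  match p with
  | 0 => fun f => f 0
  | q.+1 => fun f => (\int[lebesgue_measure]_(b in [set: R])
      integral_cV (fun v : 'cV[R]_q => f (col_mx (b%:M : 'M[R]_1) v)))%E
  end.

Definition gaussian_density (R : realType) (n : nat)
    (S : 'M[R]_n) (s : R) (u : 'cV[R]_n) : R :=
  (2 * pi * s) `^ (- (n%:R / 2)) * (\det S) `^ (- 2^-1)
  * expR (- (2 * s)^-1 * (u^T *m invmx S *m u) 0 0).

(* Integration variables: s stands for sigma^2, and beta ranges over R^p.
   Valued in \bar R, so that convergence to a real number includes finiteness. *)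
Definition likelihood (R : realType) (n r p : nat) (nu : R)
    (x : 'I_n -> 'rV[R]_r) (H : 'M[R]_(n, p)) (y : 'cV[R]_n) (theta : R) :
    \bar R :=
  (\int[lebesgue_measure]_(s in `]0%R, +oo[)
     (integral_cV (fun beta : 'cV[R]_p =>
        (gaussian_density (Sigma nu x theta) s (y - H *m beta))%:E)
      * (s^-1)%:E))%E.

(* Main.v *)
Require Import Defs.
From mathcomp Require Import measurable_realfun ring lra.

Local Open Scope classical_set_scope.
Local Open Scope ring_scope.

(** The kernel is a scale mixture of Gaussian kernels. With
    [lap w l] the integral of [w t * expR (- (l * expR (- t)))] over the line
    and [gw a t = expR (a * t - expR t)], the Matern correlation at distance [t]
    is [lap (gw nu) (nu * t ^+ 2) / Gamma nu] (lemma [maternE]). For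
    [1 < nu < 2] this mixture expands at the origin as
      [lap (gw nu) l = Gamma nu - l * Gamma (nu - 1) + l `^ nu * lap (affine_rem nu) l]
    with [affine_rem nu] positive and integrable (lemma [lap_gw_expansion]).

    In affine Kriging, [W] annihilates the constant term and, since a squared
    distance is [|x|^2 + |y|^2 - 2 <x, y>], also the term linear in
    [l = nu * |x - y|^2 / theta ^+ 2] (lemma [kernel_mx_expansion]). Only the
    last term is left: the covariance of the contrasts is
    [theta `^ (- (2 * nu))] times a matrix [F theta] (lemma [SigmaW_rescaled])
    which converges, by dominated convergence, to a positive multiple of
    [W^T *m (|x_i - x_j| ^ (2 nu)) *m W] (lemma [cvg_rescaled_SigmaW]). This
    limit is positive definite: on contrasts orthogonal to affine functions
    [|x - y| ^ (2 nu)] is again a mixture of Gaussian kernels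
    (lemma [qform_powR_gt0]), each of which is nonnegative by Schur's product
    theorem and which tend to the identity at small length scales.

    Prior at infinity. Replacing [Sigma^W] by [F] adds a multiple of the
    identity to the logarithmic derivative, and the prior, which only sees its
    trace-free part, does not change (lemma [prior_of_scale]). As [F] has an
    invertible limit, the prior is at most of the order of the derivative of [F].
    That derivative is [theta ^- 3] times a derivative of
    [lap (affine_rem nu)] at an [l] of order [theta ^- 2], which grows like
    [l `^ (1 - nu)] as [l] tends to 0; hence the order
    [theta `^ (- 2 * (2 - nu) - 1)] (lemmas [lap_affine_rem_shift_le],
    [drmat_le], [reference_prior_le]).

    Properness. The exponent is below [-1], the prior is continuous on the open
    half-line, and at [0] the correlation matrix tends to the identity and its
    derivative to [0], so that the prior has a finite limit there
    (lemmas [cvg_reference_prior_0], [integrable_half_line]).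

    Likelihood. Integrating first over the regression coefficients, by completing
    squares one coordinate at a time (lemma [integral_cV_gauss]), then over the
    variance gives, up to a constant, the classical
    [|M| ^ (- 1 / 2) * (z^T M^-1 z) ^ (- m / 2)], where [M = Sigma^W] and
    [z = W^T y] (lemma [integrated_likelihood_closed]). This is invariant under
    [M |-> c M], so that [F theta] may replace [M], and it converges to its
    value, which is positive, at the limit of [F] (lemma [cvg_likelihood]). *)

(** * Integration on the real line *)

Section substitution.
Context {R : realType}.
Let mu := @lebesgue_measure R.
Implicit Types G : R -> R.

Lemma cvg_ln_y : @ln R x @[x --> +oo] --> +oo.
Proof.
apply/cvgryPge => M; near=> x.
rewrite -(expRK M) ler_ln ?posrE ?expR_gt0//.
all: near: x; [exact: nbhs_pinfty_ge|exact: nbhs_pinfty_gt].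
Unshelve. all: end_near. Qed.

Lemma cvg_invr_y : (x : R)^-1 @[x --> +oo] --> 0.
Proof. by apply/gtr0_cvgV0; [exact: nbhs_pinfty_gt|exact: cvg_id]. Qed.

Lemma measurable_invr_gt0 (D : set R) : D `<=` `]0, +oo[ ->
  measurable_fun D (fun x : R => x^-1).
Proof.
move=> D0; apply: (@eq_measurable_fun _ _ _ _ D (fun x => x `^ (-1))).
  move=> x /set_mem/D0/=; rewrite in_itv/= andbT => x0.
  by rewrite powR_inv1// ltW.
by apply: measurable_funTS; exact: measurable_powR.
Qed.

Lemma ge0_integral_opp G : measurable_fun setT G -> (forall t, 0 <= G t) ->
  (\int[mu]_t (G t)%:E = \int[mu]_t (G (- t))%:E)%E.
Proof.
move=> mG G0.
transitivity (\int[pushforward mu (-%R : _ -> measurableTypeR R)]_t (G t)%:E)%E.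
  by apply: eq_measure_integral => /= A mA _; exact/esym/lebesgue_measureN.
by rewrite ge0_integral_pushforward//= => [|y _]; [exact/measurable_EFinP|rewrite lee_fin].
Qed.

Lemma ge0_integral_affine G (a c : R) : 0 < a -> continuous G ->
  (forall t, 0 <= G t) ->
  (\int[mu]_t (G t)%:E = \int[mu]_t (G (a * t + c) * a)%:E)%E.
Proof.
move=> a0 cG G0.
have dF (t : R) : is_derive t 1 (fun t : R => a * t + c) a.
  by apply: is_derive_eq; rewrite addr0 [LHS]mulr1.
have F'E : derive1 (fun t : R => a * t + c) = cst a.
  by apply/funext => t; rewrite derive1E; apply: derive_val.
rewrite (@increasing_ge0_integration_by_substitutionT _ (fun t => a * t + c))//.
- by rewrite F'E.
- by move=> s t st; rewrite ltrD2r ltr_pM2l.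
- by rewrite F'E => t; exact: cst_continuous.
- by rewrite F'E; exact: is_cvg_cst.
- by rewrite F'E; exact: is_cvg_cst.
- apply/cvgrNyPle => M; near=> t.
  rewrite -lerBrDr -ler_pdivlMl//; near: t; exact: nbhs_ninfty_le.
- apply/cvgryPge => M; near=> t.
  rewrite -lerBlDr -ler_pdivrMl//; near: t; exact: nbhs_pinfty_ge.
Unshelve. all: end_near. Qed.

Lemma bigcup_itvNnatcy : \bigcup_n `[- n%:R, +oo[%classic = [set: R].
Proof.
rewrite -subTset => t _; exists (Num.truncn `|t|).+1 => //=.
rewrite in_itv/= andbT lerNl; apply: ltW; apply: le_lt_trans (truncnS_gt _).
by rewrite -normrN ler_norm.
Qed.

Lemma bigcup_itv_expRN :
  \bigcup_n `[expR (- n%:R), +oo[%classic = `]0, +oo[%classic :> set R.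
Proof.
apply/seteqP; split=> [t [n _]|t]/=; rewrite !in_itv/= !andbT.
  exact: (lt_le_trans (expR_gt0 _)).
move=> t0; have : [set: R] (ln t) by [].
rewrite -bigcup_itvNnatcy => -[n _ /=]; rewrite in_itv/= andbT => nt.
by exists n => //=; rewrite in_itv/= andbT -[leRHS]lnK ?posrE// ler_expR.
Qed.

(** The substitution theorem requires a derivative that converges at infinity,
    which the logarithm has and the exponential has not. It is therefore applied
    to the logarithm, on half-lines away from 0 that exhaust the domain. *)
Lemma ge0_integral_exp G : continuous G -> (forall t, 0 <= G t) ->
  (\int[mu]_(t in setT) (G t)%:E =
   \int[mu]_(s in `]0%R, +oo[) (G (ln s) * s^-1)%:E)%E.
Proof.
move=> cG G0.
have mG : measurable_fun [set: R] G.
  exact: continuous_measurable_fun.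
have half n : (\int[mu]_(t in `[(- n%:R)%R, +oo[) (G t)%:E =
    \int[mu]_(s in `[expR (- n%:R)%R, +oo[) (G (ln s) * s^-1)%:E)%E.
  have e0 : 0 < expR (- n%:R) :> R := expR_gt0 _.
  have d1 s : 0 < s -> derive1 (@ln R) s = s^-1.
    by move=> s0; rewrite derive1E; apply: derive_val; exact: is_derive1_ln.
  rewrite -[in LHS](expRK (- n%:R)).
  rewrite (@increasing_ge0_integration_by_substitutiony _ (@ln R))//.
  - apply: eq_integral => s; rewrite inE/= in_itv/= andbT => es.
    by rewrite !fctE/= d1// (lt_le_trans e0).
  - move=> s t; rewrite !in_itv/= !andbT => es et st.
    by rewrite ltr_ln ?posrE// ?(lt_le_trans e0).
  - move=> s; rewrite in_itv/= andbT => es.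
    have s0 : 0 < s by rewrite (lt_trans e0).
    rewrite /continuous_at d1//.
    apply: (@cvg_trans _ ((fun t => t^-1) @ s)); last first.
      by apply: inv_continuous; rewrite gt_eqF.
    apply: near_eq_cvg; near=> t; rewrite d1//.
    by near: t; exact: lt_nbhsr.
  - apply/cvg_ex; exists (expR (- n%:R))^-1.
    apply: cvg_at_right_filter.
    apply: (@cvg_trans _ ((fun t => t^-1) @ (expR (- n%:R)))); last first.
      by apply: inv_continuous; rewrite gt_eqF.
    apply: near_eq_cvg; near=> t; rewrite d1//.
    by near: t; exact: lt_nbhsr.
  - apply/cvg_ex; exists 0.
    apply: (@cvg_trans _ ((fun t => t^-1) @ +oo)); last first.
      exact: cvg_invr_y.
    apply: near_eq_cvg; by near=> t; rewrite d1.
  - split.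
      move=> s; rewrite in_itv/= andbT => es.
      by apply: ex_derive; apply: is_derive1_ln; rewrite (lt_trans e0).
    by apply: cvg_at_right_filter; exact: continuous_ln.
  - exact: cvg_ln_y.
  - exact: continuous_subspaceT.
have lhs : (\int[mu]_(t in `[(- i%:R)%R, +oo[) (G t)%:E @[i --> \oo] -->
    \int[mu]_(t in setT) (G t)%:E)%E.
  rewrite -bigcup_itvNnatcy; apply: ge0_nondecreasing_set_cvg_integral => //.
  - move=> i j ij; apply/subsetPset/subset_itvr.
    by rewrite bnd_simp lerN2 ler_nat.
  - by move=> i; apply/measurable_EFinP; exact: measurable_funTS.
  - by move=> i t _; rewrite lee_fin.
have rhs : (\int[mu]_(s in `[expR (- i%:R)%R, +oo[) (G (ln s) * s^-1)%:E
    @[i --> \oo] --> \int[mu]_(s in `]0%R, +oo[) (G (ln s) * s^-1)%:E)%E.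
  rewrite -bigcup_itv_expRN; apply: ge0_nondecreasing_set_cvg_integral => //.
  - move=> i j ij; apply/subsetPset/subset_itvr.
    by rewrite bnd_simp ler_expR lerN2 ler_nat.
  - move=> i; apply/measurable_EFinP; apply: measurable_funM.
      apply: measurableT_comp => //; exact: measurable_funTS.
    apply: (@measurable_invr_gt0 _ _) => t /=; rewrite !in_itv/= !andbT.
    exact/lt_le_trans/expR_gt0.
  - move=> i t /=; rewrite in_itv/= andbT => it.
    by rewrite lee_fin mulr_ge0// invr_ge0 (le_trans _ it)// expR_ge0.
move: lhs; under eq_fun do rewrite half.
by move=> lhs; apply: cvg_unique rhs; rewrite //; exact: lhs.
Unshelve. all: end_near. Qed.

End substitution.

Section integrability.
Context {R : realType}.
Let mu := @lebesgue_measure R.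

(** Each half of the function is an exponential density up to a factor. *)
Lemma integrable_expRN_norm (b : R) : 0 < b ->
  mu.-integrable [set: R] (EFin \o (fun t => expR (- (b * `|t|)))).
Proof.
move=> b0; have /integrableP[mE iE] := integrable_exponential_pdf b0.
have iE' : mu.-integrable [set: R] (EFin \o (fun t => exponential_pdf b (- t))).
  apply/integrableP; split.
    apply/measurable_EFinP; apply: measurableT_comp => //.
    exact: measurable_exponential_pdf.
  rewrite /= -(@ge0_integral_opp _ (fun t => `|exponential_pdf b t|))//.
  apply: measurableT_comp => //; exact: measurable_exponential_pdf.
have := integrableD measurableT (integrable_exponential_pdf b0) iE'.
move/(integrableZl measurableT b^-1); apply: le_integrable => //.
  apply/measurable_EFinP; apply: measurableT_comp => //.
  by apply: measurableT_comp => //; apply: measurable_funM.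
move=> t _ /=; rewrite lee_fin ger0_norm ?expR_ge0//.
apply: le_trans (ler_norm _).
rewrite ler_pdivlMl//; have [t0|t0] := leP 0 t.
  rewrite (exponential_pdfE b t0) ger0_norm// mulNr lerDl.
  by apply: exponential_pdf_ge0; exact: ltW.
have Nt0 : 0 <= - t by rewrite oppr_ge0 ltW.
rewrite (exponential_pdfE b Nt0) ltr0_norm// mulNr lerDr.
by apply: exponential_pdf_ge0; exact: ltW.
Qed.

Lemma integrable_le_expRN_norm (f : R -> R) (C b : R) : 0 < b ->
  measurable_fun [set: R] f -> (forall t, `|f t| <= C * expR (- (b * `|t|))) ->
  mu.-integrable [set: R] (EFin \o f).
Proof.
move=> b0 mf fC.
have := integrableZl measurableT C (integrable_expRN_norm b0).
apply: le_integrable => //; first exact/measurable_EFinP.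
by move=> t _ /=; rewrite lee_fin (le_trans (fC t))// ler_norm.
Qed.

Lemma integrable_exp_subst (G : R -> R) : continuous G -> (forall t, 0 <= G t) ->
  mu.-integrable [set: R] (EFin \o G) ->
  mu.-integrable `]0%R, +oo[ (EFin \o (fun s => G (ln s) * s^-1)).
Proof.
move=> cG G0 iG; apply/integrableP; split.
  apply/measurable_EFinP; apply: measurable_funM; last exact: measurable_invr_gt0.
  apply: measurableT_comp; first exact: continuous_measurable_fun.
  by apply: measurable_funTS; exact: measurable_ln.
under eq_integral => s /set_mem s0.
  rewrite /= ger0_norm; last first.
    by move: s0; rewrite /= in_itv/= andbT => s0; rewrite mulr_ge0 ?G0// invr_ge0 ltW.
  over.
rewrite -ge0_integral_exp//; have /integrableP[_] := iG.
by under eq_integral do rewrite /= ger0_norm//.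
Qed.

(** A function with zero integral vanishes almost everywhere, which an interval
    of length 1 contradicts. *)
Lemma ge0_Rintegral_gt0 (f : R -> R) (a : R) :
  mu.-integrable [set: R] (EFin \o f) -> (forall t, 0 <= f t) ->
  (forall t, a <= t <= a + 1 -> 0 < f t) -> 0 < \int[mu]_t f t.
Proof.
move=> fi f0 fa; rewrite lt_neqAle Rintegral_ge0// andbT eq_sym.
apply/negP => /eqP if0.
have /integrableP[mf _] := fi.
have : (\int[mu]_(t in setT) `|(f t)%:E| = 0)%E.
  under eq_integral do rewrite gee0_abs ?lee_fin//.
  move: if0; rewrite /Rintegral => if0.
  by rewrite -(fineK (integrable_fin_num measurableT fi)) if0.
move/(ae_eq_integral_abs mu measurableT mf) => [N [mN N0 fN]].
have : `[a, a + 1]%classic `<=` N.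
  move=> t /=; rewrite in_itv/= => at_; apply: fN => /= /(_ I) [].
  by apply/eqP; rewrite gt_eqF// fa.
move/(le_measure mu); rewrite !inE => /(_ _ mN) => /(_ (measurable_itv _)).
rewrite [leRHS]N0 [leLHS]lebesgue_measure_itv /= lte_fin ltrDl ltr01.
by rewrite -EFinD lee_fin addrAC subrr add0r ler10.
Qed.

End integrability.

Section continuity.
Context {R : realType}.
Implicit Types f g : R -> R.

Lemma continuous_funM f g : continuous f -> continuous g ->
  continuous (fun t => f t * g t).
Proof. by move=> cf cg t; apply: continuousM; [exact: cf|exact: cg]. Qed.

Lemma continuous_funD f g : continuous f -> continuous g ->
  continuous (fun t => f t + g t).
Proof. by move=> cf cg t; apply: continuousD; [exact: cf|exact: cg]. Qed.

Lemma continuous_funN f : continuous f -> continuous (fun t => - f t).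
Proof. by move=> cf t; apply: continuousN; exact: cf. Qed.

Lemma continuous_fun_expR f : continuous f -> continuous (fun t => expR (f t)).
Proof.
by move=> cf t; apply: (@continuous_comp _ _ _ f expR);
  [exact: cf|exact: continuous_expR].
Qed.

Lemma continuous_fun_id : continuous (fun t : R => t).
Proof. by move=> t; exact: cvg_id. Qed.

Lemma continuous_fun_cst (c : R) : continuous (fun _ : R => c).
Proof. by move=> t; exact: cst_continuous. Qed.

End continuity.

(** Syntax-directed, as unification does not find the continuity lemmas for
    functions given by their bodies. *)
Ltac continuity :=
  lazymatch goal with
  | |- continuous (fun t => t) => exact: continuous_fun_id
  | |- continuous (fun t => expR (@?f t)) =>
      apply: (@continuous_fun_expR _ f); continuity
  | |- continuous (fun t => - (@?f t)) =>
      apply: (@continuous_funN _ f); continuity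
  | |- continuous (fun t => (@?f t) * (@?g t)) =>
      apply: (@continuous_funM _ f g); continuity
  | |- continuous (fun t => (@?f t) + (@?g t)) =>
      apply: (@continuous_funD _ f g); continuity
  | |- _ => exact: continuous_fun_cst
  end.

(** * Laplace transforms in logarithmic scale *)

Section laplace.
Context {R : realType}.
Let mu := @lebesgue_measure R.
Implicit Types w : R -> R.

(** The Laplace transform with respect to [1 / u], [u = expR t]. The logarithmic
    variable turns every change of scale used below into a translation. *)
Definition lap w (l : R) : R := \int[mu]_t (w t * expR (- (l * expR (- t)))).

(** Integrability at [l = 0] is left out, so that the class is stable under
    differentiation in [l], that is under multiplication by [expR (- t)]. *)
Definition lap_weight w : Prop :=
  [/\ measurable_fun [set: R] w, forall t, 0 <= w t &
      forall l, 0 < l ->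
        mu.-integrable [set: R] (EFin \o (fun t => w t * expR (- (l * expR (- t)))))].

Lemma measurable_lap_kernel (l : R) :
  measurable_fun [set: R] (fun t : R => expR (- (l * expR (- t)))).
Proof.
apply: measurableT_comp => //; apply: measurableT_comp => //.
apply: measurable_funM => //; apply: measurableT_comp => //.
Qed.

(** With [x = expR (- t)], the factor [x] is paid for by half of the exponential
    decay: [x * expR (- l x)] is at most [(2 / l) * expR (- (l / 2) x)]. *)
Lemma lap_weight_shift w : lap_weight w -> lap_weight (fun t => w t * expR (- t)).
Proof.
case=> mw w0 wi; have mw' : measurable_fun [set: R] (fun t => w t * expR (- t)).
  apply: measurable_funM => //; apply: measurableT_comp => //.
split=> // [t|l l0]; first by rewrite mulr_ge0// expR_ge0.
have l20 : 0 < l / 2 by rewrite divr_gt0.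
have := integrableZl measurableT (2 / l) (wi _ l20).
apply: le_integrable => //.
  apply/measurable_EFinP; apply: measurable_funM => //.
  exact: measurable_lap_kernel.
move=> /= t _; rewrite lee_fin !ger0_norm ?mulr_ge0 ?expR_ge0 ?divr_ge0 ?invr_ge0 ?(ltW l0)//.
set x := expR (- t); have x0 : 0 <= x := expR_ge0 _.
rewrite mulrCA -mulrA ler_wpM2l//.
have -> : - (l * x) = - (l / 2 * x) + - (l / 2 * x) by field.
rewrite expRD mulrA ler_wpM2r ?expR_ge0// expRN.
rewrite ler_pdivrMr ?expR_gt0// -ler_pdivrMl ?divr_gt0// invf_div.
by apply: le_trans (expR_ge1Dx _); rewrite lerDr.
Qed.

(** On [(l / 2, 2 l)] the derivative of the integrand in the parameter is
    dominated by its absolute value at [l / 2]. *)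
Lemma is_derive_lap w (l : R) : lap_weight w -> 0 < l ->
  is_derive l 1 (lap w) (- lap (fun t => w t * expR (- t)) l).
Proof.
move=> ww l0; have [mw w0 wi] := ww.
have [mw' w'0 w'i] := lap_weight_shift ww.
pose f (l t : R) := w t * expR (- (l * expR (- t))).
have df (x t : R) : is_derive x 1 (f ^~ t) (- (w t * expR (- t) * expR (- (x * expR (- t))))).
  apply: is_derive_eq.
  by rewrite /= !scaler0; rewrite /GRing.scale/=; ring.
have pf x t : partial1of2 f x t = - (w t * expR (- t) * expR (- (x * expR (- t)))).
  by rewrite partial1of2E; apply: derive_val.
have l20 : 0 < l / 2 by rewrite divr_gt0.
have Il : `](l / 2), (l * 2)[%classic l by rewrite /= in_itv/=; lra.
have fi x : `](l / 2), (l * 2)[%classic x -> mu.-integrable [set: R] (EFin \o f x).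
  by rewrite /= in_itv/= => /andP[lx _]; apply: wi; rewrite (lt_trans _ lx).
pose G t := w t * expR (- t) * expR (- (l / 2 * expR (- t))).
have G0 t : 0 <= G t by rewrite !mulr_ge0 ?expR_ge0.
have ub x t : `](l / 2), (l * 2)[%classic x -> [set: R] t -> `|partial1of2 f x t| <= G t.
  rewrite /= in_itv/= => /andP[lx _] _.
  rewrite pf normrN ger0_norm ?mulr_ge0 ?expR_ge0// ler_wpM2l ?w'0//.
  by rewrite ler_expR lerN2 ler_wpM2r ?expR_ge0// ltW.
have dd (x t : R) : `](l / 2), (l * 2)[%classic x -> [set: R] t -> derivable (f^~ t) x 1.
  by move=> _ _; apply: ex_derive; exact: df.
apply: DeriveDef.
  exact: (derivable_under_integral measurableT Il fi dd G0 (w'i _ l20) ub).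
rewrite -derive1E (differentiation_under_integral measurableT Il fi dd G0 (w'i _ l20) ub).
under eq_Rintegral do rewrite pf.
rewrite -mulN1r -RintegralZl//; last exact: w'i.
by apply: eq_Rintegral => t _; rewrite mulN1r.
Qed.

(** Dominated convergence, with [|w|] as the bound. The absolute value of [l]
    extends the transform to a two-sided neighbourhood of 0, on which the theorem
    on integrals depending on a parameter applies. *)
Lemma cvg_lap0 w : mu.-integrable [set: R] (EFin \o w) ->
  lap w `|l| @[l --> (0 : R)] --> lap w 0.
Proof.
move=> wi; have mw : measurable_fun [set: R] w by case/integrableP: wi => /measurable_EFinP.
have Il : (0 : R) \in (`](-1), 1[%classic : set R) by rewrite inE/= in_itv/= oppr_lt0 !ltr01.
pose f (l t : R) := w t * expR (- (`|l| * expR (- t))).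
have ub x t : `|f x t| <= `|w t|.
  by rewrite normrM ler_piMr// ger0_norm ?expR_ge0.
have fi x : `](-1), 1[%classic x -> mu.-integrable [set: R] (EFin \o f x).
  move=> _; apply: le_integrable wi => //.
    apply/measurable_EFinP; apply: measurable_funM => //.
    exact: measurable_lap_kernel.
  by move=> t _ /=; rewrite lee_fin.
have cft (t : R) : continuous (f^~ t).
  apply: (@continuous_funM _ (cst (w t))); first exact: continuous_fun_cst.
  apply: continuous_fun_expR; apply: continuous_funN.
  by apply: continuous_funM; [exact: norm_continuous|exact: continuous_fun_cst].
have cf : {ae mu, forall t, [set: R] t -> {in (`](-1), 1[%classic : set R), continuous (f^~ t)}}.
  by apply: aeW => t _ x _; exact: cft.
have wi' : mu.-integrable [set: R] (EFin \o (fun t => `|w t|)).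
  exact: (integrable_norm wi).
have := continuity_under_integral measurableT fi cf wi'.
have ae_ub x : `](-1), 1[%classic x -> {ae mu, forall t, [set: R] t -> `|f x t| <= `|w t|}.
  by move=> _; apply: aeW => t _; exact: ub.
by move=> /(_ ae_ub _ Il); rewrite /continuous_at /f normr0.
Qed.

Lemma lap_ge0 w (l : R) : (forall t, 0 <= w t) -> 0 <= lap w l.
Proof. by move=> w0; apply: Rintegral_ge0 => t _; rewrite mulr_ge0 ?expR_ge0. Qed.

Lemma integrable_lap w (l : R) : mu.-integrable [set: R] (EFin \o w) ->
  (forall t, 0 <= w t) -> 0 <= l ->
  mu.-integrable [set: R] (EFin \o (fun t => w t * expR (- (l * expR (- t))))).
Proof.
move=> wi w0 l0; have mw : measurable_fun [set: R] w by case/integrableP: wi => /measurable_EFinP.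
apply: le_integrable wi => //.
  apply/measurable_EFinP; apply: measurable_funM => //.
  exact: measurable_lap_kernel.
move=> t _ /=; rewrite lee_fin normrM ler_piMr// ger0_norm ?expR_ge0//.
by rewrite -[leRHS]expR0 ler_expR oppr_le0 mulr_ge0// expR_ge0.
Qed.

Lemma integrable_lap_weight w : mu.-integrable [set: R] (EFin \o w) ->
  (forall t, 0 <= w t) -> lap_weight w.
Proof.
move=> wi w0; split=> // [|l l0]; first by case/integrableP: wi => /measurable_EFinP.
by apply: integrable_lap => //; exact: ltW.
Qed.

Lemma le_lap w1 w2 (l c : R) :
  mu.-integrable [set: R] (EFin \o (fun t => w1 t * expR (- (l * expR (- t))))) ->
  mu.-integrable [set: R] (EFin \o w2) ->
  (forall t, w1 t * expR (- (l * expR (- t))) <= c * w2 t) ->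
  lap w1 l <= c * \int[mu]_t w2 t.
Proof.
move=> i1 i2 le12; rewrite -RintegralZl//; apply: le_Rintegral => //.
exact: (integrableZl measurableT c i2).
Qed.

End laplace.

(** * The Matern correlation as a scale mixture *)

Section matern_mixture.
Context {R : realType}.
Let mu := @lebesgue_measure R.
Implicit Types (a nu l t : R).

(** The integrand of Euler's integral for [Gamma a] in the variable [ln u]. *)
Definition gw a t : R := expR (a * t - expR t).

Lemma gw_gt0 a t : 0 < gw a t. Proof. exact: expR_gt0. Qed.

Lemma continuous_gw a : continuous (gw a).
Proof. by rewrite /gw; continuity. Qed.

Lemma measurable_gw a : measurable_fun [set: R] (gw a).
Proof. apply: continuous_measurable_fun; exact: continuous_gw. Qed.

Lemma gw_shift a t : gw a t * expR (- t) = gw (a - 1) t.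
Proof. by rewrite -expRD; congr expR; ring. Qed.

(** At [-oo] the bound is the factor [expR (a * t)]; at [+oo] the inner
    exponential beats every linear term, as [expR t >= (1 + t / 2) ^+ 2]. *)
Lemma integrable_gw a : 0 < a -> mu.-integrable [set: R] (EFin \o gw a).
Proof.
move=> a0; pose b := Num.min a 1.
have b0 : 0 < b by rewrite lt_min a0 ltr01.
have ba : b <= a by rewrite ge_min lexx.
have b1 : b <= 1 by rewrite ge_min lexx orbT.
apply: (@integrable_le_expRN_norm _ _ (expR ((a + 1) ^+ 2)) b) => //.
  exact: measurable_gw.
move=> t; rewrite ger0_norm ?expR_ge0// -expRD ler_expR.
have [t0|t0] := leP 0 t.
  have h : 1 + t / 2 <= expR (t / 2) := expR_ge1Dx _.
  have e : expR t = expR (t / 2) ^+ 2 by rewrite expr2 -expRD; congr expR; field.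
  have : (1 + t / 2) ^+ 2 <= expR t.
    by rewrite e ler_sqr// nnegrE ?expR_ge0//; nra.
  move: (expR t) => E hE; rewrite ger0_norm//.
  have bt : b * t <= t by rewrite ler_piMl.
  by have := sqr_ge0 (a + 1 - t / 2); lra.
have := expR_ge0 t; move: (expR t) => E hE.
rewrite ltr0_norm// mulrN opprK.
have bt : a * t <= b * t by rewrite ler_nM2r.
by have := sqr_ge0 (a + 1); move: ((a + 1) ^+ 2) => K; lra.
Qed.

Lemma lap0E (w : R -> R) : lap w 0 = \int[mu]_t w t.
Proof. by apply: eq_Rintegral => t _; rewrite mul0r oppr0 expR0 mulr1. Qed.

Lemma powR_expR l a : 0 < l -> l `^ a = expR (a * ln l).
Proof. by move=> l0; rewrite /powR gt_eqF. Qed.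

Lemma GammaE a : Gamma a = \int[mu]_t gw a t.
Proof.
rewrite /Gamma /Rintegral; congr fine.
rewrite (ge0_integral_exp (@continuous_gw a)) => [|t]; last exact/ltW/gw_gt0.
apply: eq_integral => s /set_mem/=; rewrite in_itv/= andbT => s0; congr EFin.
rewrite powR_expR// /gw -[X in _ / X](@lnK _ s) ?posrE//.
by rewrite -expRN -!expRD lnK ?posrE//; congr expR; ring.
Qed.

Lemma Gamma_gt0 a : 0 < a -> 0 < Gamma a.
Proof.
move=> a0; rewrite GammaE; apply: (@ge0_Rintegral_gt0 _ _ 0).
- exact: integrable_gw.
- by move=> t; exact/ltW/gw_gt0.
- by move=> t _; exact: gw_gt0.
Qed.

Lemma ge0_Rintegral_shift (G : R -> R) (c : R) : continuous G ->
  (forall t, 0 <= G t) -> \int[mu]_t G t = \int[mu]_t G (t + c).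
Proof.
move=> cG G0; rewrite /Rintegral (@ge0_integral_affine _ _ 1 c)//.
by congr fine; apply: eq_integral => t _; rewrite mulr1 mul1r.
Qed.

Lemma ge0_Rintegral_opp (G : R -> R) : measurable_fun [set: R] G ->
  (forall t, 0 <= G t) -> \int[mu]_t G t = \int[mu]_t G (- t).
Proof. by move=> mG G0; rewrite /Rintegral ge0_integral_opp. Qed.

(** The integrand is even, so that the half-line may be replaced by the line and
    the factor [cosh (nu t)] by [expR (nu t)]; translating by [ln (z / 2)] then
    separates the two exponentials of [z * cosh t]. *)
Lemma besselKE nu z : 0 < nu -> 0 < z ->
  besselK nu z = 2^-1 * (z / 2) `^ (- nu) * lap (gw nu) (z ^+ 2 / 4).
Proof.
move=> nu0 z0; have z20 : 0 < z / 2 by rewrite divr_gt0.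
pose G t : R := expR (nu * t - z * cosh t).
have cG : continuous G by rewrite /G/cosh; continuity.
have mG := continuous_measurable_fun cG.
have G0 t : 0 <= G t := expR_ge0 _.
pose f t : R := expR (- (z * cosh t)) * cosh (nu * t).
have fE t : f t = 2^-1 * (G t + G (- t)).
  rewrite /f /G {2}/cosh !expRD.
  have -> : cosh (- t) = cosh t by rewrite /cosh opprK addrC.
  by rewrite mulrN; field.
have f0 t : 0 <= f t by rewrite fE mulr_ge0 ?addr_ge0.
have cGN : continuous (fun t => G (- t)) by rewrite /G/cosh; continuity.
have cf : continuous f by rewrite /f/cosh; continuity.
have intGlap : (\int[mu]_t (G t)%:E =
    \int[mu]_t ((z / 2) `^ (- nu) * (gw nu t * expR (- (z ^+ 2 / 4 * expR (- t)))))%:E)%E.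
  rewrite (@ge0_integral_affine _ _ 1 (- ln (z / 2)))//.
  apply: eq_integral => t _; congr EFin; rewrite mulr1 mul1r /gw powR_expR//.
  rewrite -!expRD; congr expR; rewrite /cosh.
  rewrite opprB (addrC (ln _)) !expRD expRN lnK ?posrE//.
  by have := gt_eqF z0; move: (expR t) (expR (- t)) => E F z0'; field; rewrite z0'.
have fint : (\int[mu]_(t in `]0%R, +oo[) (f t)%:E = 2^-1%:E * \int[mu]_t (G t)%:E)%E.
  have sym := ge0_symfun_integralT f0 cf.
  have : f =1 f \o -%R by move=> t; rewrite /= !fE opprK addrC.
  move=> /sym {}sym.
  have : (\int[mu]_t (f t)%:E = \int[mu]_t (G t)%:E)%E.
    under eq_integral do rewrite fE EFinM EFinD.
    have mGe : measurable_fun [set: R] (fun t => (G t)%:E) by exact/measurable_EFinP.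
    have mGNe : measurable_fun [set: R] (fun t => (G (- t))%:E).
      by apply/measurable_EFinP; exact: (continuous_measurable_fun cGN).
    rewrite ge0_integralZl//; last 2 first.
    - exact: emeasurable_funD.
    - by move=> t _; rewrite adde_ge0// lee_fin.
    rewrite ge0_integralD//; [|by move=> t _; rewrite lee_fin..].
    rewrite -ge0_integral_opp// -mule2n -mule_natl muleA -EFinM.
    by rewrite mulVf// mul1e.
  move=> <-; rewrite {}sym -set_itvcy muleA -EFinM mulVf// mul1e.
  by rewrite integral_itv_obnd_cbnd//; apply/measurable_EFinP; apply: measurable_funTS;
    exact: continuous_measurable_fun.
have z24 : 0 <= z ^+ 2 / 4 by rewrite divr_ge0// sqr_ge0.
have gi := integrable_lap (integrable_gw nu0) (fun t => ltW (gw_gt0 nu t)) z24.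
rewrite /besselK /Rintegral fint intGlap.
under eq_integral do rewrite EFinM.
rewrite integralZl// /lap /Rintegral -(fineK (integrable_fin_num measurableT gi)).
by rewrite -!EFinM /= mulrA.
Qed.

Lemma maternE nu t : 0 < nu -> 0 <= t ->
  matern nu t = lap (gw nu) (nu * t ^+ 2) / Gamma nu.
Proof.
move=> nu0; rewrite /matern le_eqVlt eq_sym; case: eqVneq => [-> _|_ /= t0].
  by rewrite expr0n/= mulr0 lap0E -GammaE divff// gt_eqF// Gamma_gt0.
have s0 : 0 < Num.sqrt nu by rewrite sqrtr_gt0.
have z0 : 0 < 2 * Num.sqrt nu * t by rewrite !mulr_gt0.
rewrite besselKE// (_ : _ ^+ 2 / 4 = nu * t ^+ 2); last first.
  by rewrite !exprMn sqr_sqrtr ?ltW//; field.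
rewrite (_ : 2 * Num.sqrt nu * t / 2 = Num.sqrt nu * t); last by field.
set L := lap _ _; set G := Gamma _.
have p0 : 0 < Num.sqrt nu * t by rewrite mulr_gt0.
have -> : (2 * Num.sqrt nu * t) `^ nu = 2 `^ nu * (Num.sqrt nu * t) `^ nu.
  by rewrite -mulrA powRM// ltW.
rewrite powRN powRB ?powRr1 ?pnatr_eq0 ?implybT//.
have h2 : 2 `^ nu != 0 :> R by rewrite gt_eqF// powR_gt0.
have hp : (Num.sqrt nu * t) `^ nu != 0 by rewrite gt_eqF// powR_gt0.
have G0 : G != 0 by rewrite gt_eqF// Gamma_gt0.
by field; rewrite h2 hp G0.
Qed.

(** The part of the mixture that survives the annihilation of affine functions
    of the squared distance. *)
Definition affine_rem nu t : R := expR (- (nu * t)) * (expR (- expR t) - 1 + expR t).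

Lemma affine_rem_ge0 nu t : 0 <= affine_rem nu t.
Proof.
rewrite mulr_ge0 ?expR_ge0//; have := expR_ge1Dx (- expR t); lra.
Qed.

Lemma affine_rem_gt0 nu t : 0 < affine_rem nu t.
Proof.
rewrite mulr_gt0 ?expR_gt0//.
have := @expR_gt1Dx R (- expR t); rewrite oppr_eq0 gt_eqF ?expR_gt0// => /(_ isT).
lra.
Qed.

Lemma expRN_sub1D_le (x : R) : 0 <= x ->
  (expR (- x) - 1 + x <= x ^+ 2) && (expR (- x) - 1 + x <= x).
Proof.
move=> x0; have e1 : expR (- x) <= 1 by rewrite -[leRHS]expR0 ler_expR oppr_le0.
have ex : expR (- x) * expR x = 1 by rewrite -expRD addNr expR0.
have := expR_ge1Dx x; have := expR_ge0 (- x).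
by move: (expR (- x)) (expR x) e1 ex => E F e1 ex E0 hF; apply/andP; split; nra.
Qed.

Lemma affine_rem_le_sqr nu t : affine_rem nu t <= expR ((2 - nu) * t).
Proof.
have /andP[h _] := expRN_sub1D_le (expR_ge0 t).
apply: (@le_trans _ _ (expR (- (nu * t)) * expR t ^+ 2)).
  by rewrite ler_wpM2l// expR_ge0.
by rewrite expr2 -!expRD ler_expR; lra.
Qed.

(** The remainder of [expR (- x)], [x = q * expR t], is at most [x ^+ 2] and at
    most [x]. The first bound gives decay at [-oo] because [nu < 2], the second
    at [+oo] because [1 < nu]. *)
Lemma integrable_scaled_rem nu q : 1 < nu < 2 -> 0 <= q ->
  mu.-integrable [set: R] (EFin \o
    (fun t => expR (- (nu * t)) * (expR (- (q * expR t)) - 1 + q * expR t))).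
Proof.
move=> /andP[nu1 nu2] q0; pose b := Num.min (2 - nu) (nu - 1).
have b0 : 0 < b by rewrite lt_min !subr_gt0 nu2.
have bl : b <= 2 - nu by rewrite ge_min lexx.
have br : b <= nu - 1 by rewrite ge_min lexx orbT.
apply: (@integrable_le_expRN_norm _ _ (q ^+ 2 + q) b) => //.
  apply: continuous_measurable_fun; continuity.
move=> t; have qt0 : 0 <= q * expR t by rewrite mulr_ge0 ?expR_ge0.
have /andP[h2 h1] := expRN_sub1D_le qt0.
have rem0 : 0 <= expR (- (q * expR t)) - 1 + q * expR t.
  by have := expR_ge1Dx (- (q * expR t)); lra.
rewrite ger0_norm ?mulr_ge0 ?expR_ge0//.
have [t0|t0] := leP 0 t.
  apply: (@le_trans _ _ (q * expR ((1 - nu) * t))).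
    apply: (le_trans (ler_wpM2l (expR_ge0 _) h1)).
    by rewrite mulrCA -expRD ler_wpM2l// ler_expR; lra.
  apply: ler_pM; rewrite ?expR_ge0// ?lerDr ?sqr_ge0//.
  by rewrite ler_expR ger0_norm//; nra.
apply: (@le_trans _ _ (q ^+ 2 * expR ((2 - nu) * t))).
  apply: (le_trans (ler_wpM2l (expR_ge0 _) h2)).
  by rewrite exprMn mulrCA (expr2 (expR t)) -!expRD ler_wpM2l ?sqr_ge0// ler_expR; lra.
apply: ler_pM; rewrite ?expR_ge0 ?sqr_ge0 ?lerDl//.
by rewrite ler_expR ltr0_norm//; nra.
Qed.

Lemma integrable_affine_rem nu : 1 < nu < 2 ->
  mu.-integrable [set: R] (EFin \o affine_rem nu).
Proof.
move=> nu12; rewrite (_ : affine_rem nu = fun t => expR (- (nu * t)) *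
    (expR (- (1 * expR t)) - 1 + 1 * expR t)).
  exact: integrable_scaled_rem.
by apply/funext => t; rewrite /affine_rem !mul1r.
Qed.

Lemma integral_affine_rem_gt0 nu : 1 < nu < 2 -> 0 < \int[mu]_t affine_rem nu t.
Proof.
move=> nu12; apply: (@ge0_Rintegral_gt0 _ _ 0).
- exact: integrable_affine_rem.
- by move=> t; exact: affine_rem_ge0.
- by move=> t _; exact: affine_rem_gt0.
Qed.

Lemma ge0_Rintegral_reflect (G : R -> R) (c : R) : continuous G ->
  (forall t, 0 <= G t) -> \int[mu]_t G t = \int[mu]_t G (c - t).
Proof.
move=> cG G0; rewrite (ge0_Rintegral_shift c cG G0).
rewrite (@ge0_Rintegral_opp (fun t => G (t + c)))//.
  by apply: eq_Rintegral => t _; rewrite addrC.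
apply: measurableT_comp; first exact: continuous_measurable_fun.
exact: measurable_funD.
Qed.

(** The reflection [t |-> ln l - t] exchanges [expR t] and [l * expR (- t)],
    hence turns the last term into the integral of [gw nu] against the Taylor
    remainder of order 2 of [expR (- (l * expR (- t)))]. *)
Lemma lap_gw_expansion nu l : 1 < nu < 2 -> 0 < l ->
  lap (gw nu) l =
  Gamma nu - l * Gamma (nu - 1) + l `^ nu * lap (affine_rem nu) l.
Proof.
move=> nu12 l0; have /andP[nu1 nu2] := nu12.
have nu0 : 0 < nu by lra.
have nu10 : 0 < nu - 1 by lra.
have -> : l `^ nu * lap (affine_rem nu) l =
    \int[mu]_t ((gw nu t * expR (- (l * expR (- t))) - gw nu t) + l * gw (nu - 1) t).
  have ari : mu.-integrable [set: R]
      (EFin \o (fun t => affine_rem nu t * expR (- (l * expR (- t))))).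
    apply: integrable_lap; [exact: integrable_affine_rem|exact: affine_rem_ge0|exact: ltW].
  pose G t := l `^ nu * (affine_rem nu t * expR (- (l * expR (- t)))).
  have G0 t : 0 <= G t.
    by rewrite mulr_ge0 ?powR_ge0// mulr_ge0 ?affine_rem_ge0 ?expR_ge0.
  have cG : continuous G by rewrite /G /affine_rem; continuity.
  rewrite /lap -(RintegralZl _ measurableT ari) -/(G _) (ge0_Rintegral_reflect (ln l) cG G0).
  apply: eq_Rintegral => t _; rewrite -gw_shift /G /affine_rem powR_expR// opprB.
  have e1 : expR (ln l - t) = l * expR (- t) by rewrite expRD lnK ?posrE.
  have e2 : l * expR (t - ln l) = expR t.
    by rewrite expRD expRN lnK ?posrE// mulrCA divff ?mulr1// gt_eqF.
  have e3 : expR (nu * ln l) * expR (- (nu * (ln l - t))) = expR (nu * t).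
    by rewrite -expRD; congr expR; ring.
  rewrite e1 e2 /gw expRD -e3; ring.
have gi := integrable_gw nu0.
have gi1 := integrable_gw nu10.
have gli := integrable_lap gi (fun t => ltW (gw_gt0 nu t)) (ltW l0).
have gli1 := integrableZl measurableT l gi1.
have gsub := integrableB measurableT gli gi.
rewrite (RintegralD measurableT gsub gli1) (RintegralB measurableT gli gi).
by rewrite (RintegralZl _ measurableT gi1) -!GammaE /lap; ring.
Qed.

(** The same reflection, with [affine_rem nu t <= expR ((2 - nu) * t)]: the
    integrand becomes at most [l `^ (1 - nu) * gw (nu - 1)]. The transform
    diverges as [l] tends to 0, and this is its rate. *)
Lemma lap_affine_rem_shift_le nu l : 1 < nu < 2 -> 0 < l ->
  lap (fun t => affine_rem nu t * expR (- t)) l <= l `^ (1 - nu) * Gamma (nu - 1).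
Proof.
move=> nu12 l0; have /andP[nu1 nu2] := nu12.
have nu10 : 0 < nu - 1 by lra.
pose G t := affine_rem nu t * expR (- t) * expR (- (l * expR (- t))).
have G0 t : 0 <= G t.
  by rewrite mulr_ge0 ?expR_ge0// mulr_ge0 ?affine_rem_ge0 ?expR_ge0.
have cG : continuous G by rewrite /G /affine_rem; continuity.
have cGr : continuous (fun t => G (ln l - t)) by rewrite /G /affine_rem; continuity.
have le_G t : G (ln l - t) <= l `^ (1 - nu) * gw (nu - 1) t.
  rewrite /G /gw opprB.
  have e2 : l * expR (t - ln l) = expR t.
    by rewrite expRD expRN lnK ?posrE// mulrCA divff ?mulr1// gt_eqF.
  rewrite e2 powR_expR//.
  have := affine_rem_le_sqr nu (ln l - t).
  move/(ler_wpM2r (expR_ge0 (t - ln l)))/(ler_wpM2r (expR_ge0 (- expR t))).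
  move/le_trans; apply.
  by rewrite -!expRD ler_expR; lra.
have gi := integrableZl measurableT (l `^ (1 - nu)) (integrable_gw nu10).
rewrite /lap -/(G _) (ge0_Rintegral_reflect (ln l) cG G0) GammaE.
rewrite -RintegralZl//; last exact: integrable_gw.
apply: le_Rintegral => //.
apply: le_integrable gi => //.
  by apply/measurable_EFinP; exact: (continuous_measurable_fun cGr).
by move=> t _ /=; rewrite lee_fin ger0_norm// (le_trans (le_G t))// ler_norm.
Qed.

(** Translation by [ln q]. The power thus becomes, up to a constant, a mixture of
    Gaussian kernels from which an affine function of [q] has been removed. *)
Lemma powR_mixture nu q : 1 < nu < 2 -> 0 <= q ->
  q `^ nu * \int[mu]_t affine_rem nu t =
  \int[mu]_t (expR (- (nu * t)) * (expR (- (q * expR t)) - 1 + q * expR t)).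
Proof.
move=> nu12; have nu0 : nu != 0 by case/andP: nu12 => *; rewrite gt_eqF//; lra.
rewrite le_eqVlt => /predU1P[<-|q0].
  rewrite powR0// mul0r; apply/esym.
  under eq_Rintegral do rewrite !mul0r oppr0 expR0 subrr addr0 mulr0.
  by rewrite Rintegral_cst// mul0r.
rewrite -RintegralZl//; last exact: integrable_affine_rem.
pose G t := q `^ nu * affine_rem nu t.
have G0 t : 0 <= G t by rewrite mulr_ge0 ?powR_ge0 ?affine_rem_ge0.
have cG : continuous G by rewrite /G /affine_rem; continuity.
rewrite -/(G _) (ge0_Rintegral_shift (ln q) cG G0).
apply: eq_Rintegral => t _; rewrite /G /affine_rem powR_expR//.
have -> : expR (t + ln q) = q * expR t by rewrite expRD lnK ?posrE// mulrC.
by rewrite mulrA -expRD; congr (expR _ * _); ring.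
Qed.

End matern_mixture.

(** * Positive definiteness of Gaussian mixtures *)

Section finite_cvg.
Context {R : realType} {T : Type} (F : set_system T) {FF : Filter F}.
Context {I : Type} (r : seq I) (P : pred I).

Lemma cvg_sumr (f : I -> T -> R) (l : I -> R) :
  (forall i, P i -> f i x @[x --> F] --> l i) ->
  \sum_(i <- r | P i) f i x @[x --> F] --> \sum_(i <- r | P i) l i.
Proof. by apply: cvg_big => //; exact: add_continuous. Qed.

Lemma cvg_prodr (f : I -> T -> R) (l : I -> R) :
  (forall i, P i -> f i x @[x --> F] --> l i) ->
  \prod_(i <- r | P i) f i x @[x --> F] --> \prod_(i <- r | P i) l i.
Proof. by apply: cvg_big => //; exact: mul_continuous. Qed.

End finite_cvg.

Section positive_kernels.
Context {R : realType} {n : nat}.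
Implicit Types (v : 'I_n -> R) (k : 'I_n -> 'I_n -> R).

Definition qform v k : R := \sum_i \sum_j v i * v j * k i j.

(** Positive semidefiniteness in the form of a finite sum of rank one kernels,
    for which Schur's product theorem is the distributive law. *)
Definition gram k : Prop :=
  exists s : seq ('I_n -> R), forall i j, k i j = \sum_(f <- s) f i * f j.

Lemma gram_rank1 (f : 'I_n -> R) : gram (fun i j => f i * f j).
Proof. by exists [:: f] => i j; rewrite big_seq1. Qed.

Lemma gram0 : gram (fun _ _ => 0).
Proof. by exists [::] => i j; rewrite big_nil. Qed.

Lemma gramD k1 k2 : gram k1 -> gram k2 -> gram (fun i j => k1 i j + k2 i j).
Proof.
by move=> [s1 e1] [s2 e2]; exists (s1 ++ s2) => i j; rewrite big_cat e1 e2.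
Qed.

Lemma gramM k1 k2 : gram k1 -> gram k2 -> gram (fun i j => k1 i j * k2 i j).
Proof.
move=> [s1 e1] [s2 e2].
exists [seq (fun i => f i * g i) | f <- s1, g <- s2] => i j.
rewrite big_allpairs_dep e1 e2 mulr_suml; apply: eq_bigr => f _.
by rewrite mulr_sumr; apply: eq_bigr => g _; rewrite mulrACA.
Qed.

Lemma gramZ c k : 0 <= c -> gram k -> gram (fun i j => c * k i j).
Proof.
move=> c0; have e : c = Num.sqrt c * Num.sqrt c by rewrite -expr2 sqr_sqrtr.
by move/(gramM (gram_rank1 (fun _ => Num.sqrt c))); rewrite -e.
Qed.

Lemma gram_sum (I : Type) (r : seq I) (k : I -> 'I_n -> 'I_n -> R) :
  (forall m, gram (k m)) -> gram (fun i j => \sum_(m <- r) k m i j).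
Proof.
move=> kg; elim: r => [|m r IH].
  by case: gram0 => s e; exists s => i j; rewrite big_nil; exact: e.
by case: (gramD (kg m) IH) => s e; exists s => i j; rewrite big_cons e.
Qed.

Lemma gramX k m : gram k -> gram (fun i j => k i j ^+ m).
Proof.
move=> kg; elim: m => [|m IH].
  by case: (gram_rank1 (fun _ => 1)) => s e; exists s => i j; rewrite -e mulr1.
by case: (gramM kg IH) => s e; exists s => i j; rewrite exprS e.
Qed.

Lemma qform_gram_ge0 v k : gram k -> 0 <= qform v k.
Proof.
move=> [s e]; rewrite (_ : qform v k = \sum_(f <- s) (\sum_i v i * f i) ^+ 2).
  by apply: sumr_ge0 => f _; rewrite sqr_ge0.
rewrite /qform; under eq_bigr do under eq_bigr do rewrite e mulr_sumr.
under eq_bigr do rewrite exchange_big/=.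
rewrite exchange_big/=; apply: eq_bigr => f _.
rewrite expr2 mulr_suml; apply: eq_bigr => i _.
by rewrite mulr_sumr; apply: eq_bigr => j _; ring.
Qed.

Lemma cvg_qform (T : Type) (F : set_system T) (FF : Filter F) v
    (k : T -> 'I_n -> 'I_n -> R) (l : 'I_n -> 'I_n -> R) :
  (forall i j, k x i j @[x --> F] --> l i j) ->
  qform v (k x) @[x --> F] --> qform v l.
Proof.
move=> kl; apply: cvg_sumr => i _; apply: cvg_sumr => j _.
by apply: cvgM; [exact: cvg_cst|exact: kl].
Qed.

Lemma invr_fact_ge0 p : 0 <= (p`!%:R)^-1 :> R.
Proof. by rewrite invr_ge0. Qed.

(** Schur: each Taylor polynomial of the exponential of a Gram kernel is one. *)
Lemma qform_expR_ge0 v k : gram k -> 0 <= qform v (fun i j => expR (k i j)).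
Proof.
move=> kg; have : qform v (fun i j => series (exp_coeff (k i j)) m) @[m --> \oo]
    --> qform v (fun i j => expR (k i j)).
  by apply: cvg_qform => i j; exact: is_cvg_series_exp_coeff.
move/cvgr_to_ge; apply; apply: nearW => m; apply: qform_gram_ge0.
apply: gram_sum => p; rewrite /exp_coeff /=.
have [s e] := gramZ (@invr_fact_ge0 p) (gramX p kg).
by exists s => i j; rewrite mulrC e.
Qed.

Lemma qform_diag v k (f : 'I_n -> R) :
  qform v (fun i j => f i * f j * k i j) = qform (fun i => v i * f i) k.
Proof. by apply: eq_bigr => i _; apply: eq_bigr => j _; ring. Qed.

Lemma Rintegral_qform v (k : R -> 'I_n -> 'I_n -> R) :
  (forall i j, (@lebesgue_measure R).-integrable [set: R] (EFin \o (fun t => k t i j))) ->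
  (@lebesgue_measure R).-integrable [set: R] (EFin \o (fun t => qform v (k t))) /\
  \int[lebesgue_measure]_t qform v (k t) =
    qform v (fun i j => \int[lebesgue_measure]_t k t i j).
Proof.
move=> ki.
have kvi i j := integrableZl measurableT (v i * v j) (ki i j).
have sumE t : (qform v (k t))%:E = (\sum_i \sum_j (v i * v j)%:E * (k t i j)%:E)%E.
  rewrite /qform -sumEFin; apply: eq_bigr => i _; rewrite -sumEFin.
  by apply: eq_bigr => j _; rewrite EFinM.
have kvi2 i := @integrable_sum _ _ _ (@lebesgue_measure R) _ measurableT _ (index_enum _) xpredT _ (fun j _ => kvi i j).
split.
  rewrite (_ : _ \o _ = fun t => (\sum_i \sum_j (v i * v j)%:E * (k t i j)%:E)%E).
    exact: integrable_sum.
  by apply/funext => t /=; rewrite sumE.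
rewrite /Rintegral; under eq_integral do rewrite sumE.
suff -> : (\int[lebesgue_measure]_t (\sum_i \sum_j (v i * v j)%:E * (k t i j)%:E) =
    (qform v (fun i j => \int[lebesgue_measure]_t k t i j))%:E)%E by [].
rewrite (integral_sum measurableT kvi2) /qform -sumEFin; apply: eq_bigr => i _.
rewrite (integral_sum measurableT (kvi i)) -sumEFin; apply: eq_bigr => j _.
rewrite (integralZl measurableT (ki i j)) [RHS]EFinM; congr (_ * _)%E.
by rewrite /Rintegral fineK//; exact: (integrable_fin_num measurableT (ki i j)).
Qed.

End positive_kernels.

Section gaussian_kernel.
Context {R : realType} {n r : nat}.
Variable x : 'I_n -> 'rV[R]_r.
Implicit Types (v : 'I_n -> R).

Definition sqdist (i j : 'I_n) : R := \sum_(k < r) (x i - x j) 0 k ^+ 2.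

Lemma sqdist_ge0 i j : 0 <= sqdist i j.
Proof. by apply: sumr_ge0 => k _; exact: sqr_ge0. Qed.

Lemma sqdistxx i : sqdist i i = 0.
Proof. by apply: big1 => k _; rewrite subrr mxE expr0n. Qed.

Lemma sqdist_gt0 i j : injective x -> i != j -> 0 < sqdist i j.
Proof.
move=> xinj ij; rewrite lt_neqAle sqdist_ge0 andbT eq_sym; apply/negP.
rewrite psumr_eq0 => [/allP h|k _]; last exact: sqr_ge0.
move/eqP: ij; apply; apply: xinj; apply/eqP; rewrite -subr_eq0; apply/eqP.
apply/rowP => k; rewrite [RHS]mxE; apply/eqP.
by have := h k (mem_index_enum _); rewrite sqrf_eq0.
Qed.

Lemma norm2_sqdist i j : norm2 (x i - x j) ^+ 2 = sqdist i j.
Proof. by rewrite sqr_sqrtr// sqdist_ge0. Qed.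

Definition dotp (i j : 'I_n) : R := \sum_(k < r) x i 0 k * x j 0 k.

Lemma sqdistE i j : sqdist i j = dotp i i + dotp j j - 2 * dotp i j.
Proof.
rewrite /sqdist /dotp mulr_sumr -big_split/= -sumrB; apply: eq_bigr => k _.
by rewrite !mxE; ring.
Qed.

(** Polarisation: [expR (- s |x - y|^2)] is [expR (2 s <x, y>)] up to the factors
    [expR (- s |x|^2)] and [expR (- s |y|^2)], which only rescale the vector. *)
Lemma qform_gauss_ge0 v s : 0 <= s ->
  0 <= qform v (fun i j => expR (- (s * sqdist i j))).
Proof.
move=> s0; pose f i := expR (- (s * dotp i i)).
have -> : qform v (fun i j => expR (- (s * sqdist i j))) =
    qform v (fun i j => f i * f j * expR (2 * s * dotp i j)).
  apply: eq_bigr => i _; apply: eq_bigr => j _; congr (_ * _).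
  by rewrite -!expRD sqdistE; congr expR; ring.
rewrite qform_diag; apply: qform_expR_ge0.
apply: gramZ; first by rewrite mulr_ge0.
by apply: gram_sum => k; exact: gram_rank1.
Qed.

(** The points being distinct, the kernel matrix tends to the identity as [s]
    tends to infinity. *)
Lemma qform_gauss_gt0 v : injective x -> (exists i, v i != 0) ->
  exists M, forall s, M < s -> 0 < qform v (fun i j => expR (- (s * sqdist i j))).
Proof.
move=> xinj [i0 vi0].
have : qform v (fun i j => expR (- (s * sqdist i j))) @[s --> +oo]
    --> qform v (fun i j => (i == j)%:R).
  apply: cvg_qform => i j; case: eqVneq => [->|ij].
    by rewrite sqdistxx; under eq_fun do rewrite mulr0 oppr0 expR0; exact: cvg_cst.
  apply: (cvg_comp (fun s => s * sqdist i j) (fun t => expR (- t))); last exact: cvgr_expR.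
  by apply: gt0_cvgMly; [exact: sqdist_gt0|exact: cvg_id].
have d0 : 0 < qform v (fun i j => (i == j)%:R).
  rewrite /qform (bigD1 i0)//=.
  have e i : \sum_j v i * v j * (i == j)%:R = v i ^+ 2.
    rewrite (bigD1 i)//= eqxx mulr1 big1 ?addr0// => j ji.
    by rewrite eq_sym (negbTE ji) mulr0.
  rewrite e ltr_pwDl ?exprn_even_gt0//.
  by apply: sumr_ge0 => i _; rewrite e sqr_ge0.
move/cvgr_gt => /(_ _ d0) [M [_ hM]]; exists M => s Ms; exact: hM.
Qed.

End gaussian_kernel.

Section mixtures.
Context {R : realType} {n r : nat}.
Variable x : 'I_n -> 'rV[R]_r.
Hypothesis xinj : injective x.
Implicit Types (v : 'I_n -> R).

(** The quadratic form is the mixture of the forms of Gaussian kernels. All of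
    them are nonnegative, and those with large scale, at [t] near [-oo], are
    positive. *)
Lemma qform_lap_gt0 v (nu l : R) : 0 < nu -> 0 < l -> (exists i, v i != 0) ->
  0 < qform v (fun i j => lap (gw nu) (l * sqdist x i j)).
Proof.
move=> nu0 l0 v0; pose k (t : R) i j := gw nu t * expR (- (l * sqdist x i j * expR (- t))).
have ki i j : (@lebesgue_measure R).-integrable [set: R] (EFin \o (fun t => k t i j)).
  apply: integrable_lap; [exact: integrable_gw|by move=> t; exact/ltW/gw_gt0|].
  by rewrite mulr_ge0 ?sqdist_ge0// ltW.
have [qi qE] := Rintegral_qform v ki.
rewrite /lap -/(k _ _ _) -qE.
have kE t : qform v (k t) =
    gw nu t * qform v (fun i j => expR (- (l * expR (- t) * sqdist x i j))).
  rewrite /qform mulr_sumr; apply: eq_bigr => i _.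
  rewrite mulr_sumr; apply: eq_bigr => j _.
  by rewrite /k mulrCA; congr (_ * (_ * expR (- _))); ring.
have [M hM] := qform_gauss_gt0 xinj v0.
apply: (@ge0_Rintegral_gt0 _ _ (- (M / l) - 1)) => // t.
  by rewrite kE mulr_ge0 ?(ltW (gw_gt0 _ _))// qform_gauss_ge0// mulr_ge0 ?expR_ge0// ltW.
move=> /andP[_ th]; rewrite kE mulr_gt0 ?gw_gt0//; apply: hM.
rewrite mulrC -ltr_pdivrMr//; apply: lt_le_trans (expR_ge1Dx _).
by move: th; move: (M / l) => c; lra.
Qed.

(** The affine parts removed in [powR_mixture] do not contribute to the form of
    [v], so that it is a mixture of the forms of the Gaussian kernels, of which
    those with large scale are positive. *)
Lemma qform_powR_gt0 v (nu : R) : 1 < nu < 2 -> (exists i, v i != 0) ->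
  qform v (fun _ _ => 1) = 0 -> qform v (sqdist x) = 0 ->
  0 < qform v (fun i j => sqdist x i j `^ nu).
Proof.
move=> nu12 v0 v1 vd.
have c0 := integral_affine_rem_gt0 nu12.
rewrite -(pmulr_lgt0 _ c0).
pose k (t : R) i j := expR (- (nu * t)) *
  (expR (- (sqdist x i j * expR t)) - 1 + sqdist x i j * expR t).
have -> : qform v (fun i j => sqdist x i j `^ nu) * \int[lebesgue_measure]_t affine_rem nu t
   = qform v (fun i j => \int[lebesgue_measure]_t k t i j).
  rewrite /qform mulr_suml; apply: eq_bigr => i _; rewrite mulr_suml.
  by apply: eq_bigr => j _; rewrite -mulrA powR_mixture ?sqdist_ge0.
have ki i j : (@lebesgue_measure R).-integrable [set: R] (EFin \o (fun t => k t i j)).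
  by apply: integrable_scaled_rem => //; exact: sqdist_ge0.
have [qi <-] := Rintegral_qform v ki.
have kE t : qform v (k t) =
    expR (- (nu * t)) * qform v (fun i j => expR (- (expR t * sqdist x i j))).
  rewrite -[RHS]addr0 -(mulr0 (- expR (- (nu * t)))) -[in X in _ + X]v1.
  rewrite -[RHS]addr0 -(mulr0 (expR (- (nu * t)) * expR t)) -[in X in _ + _ + X]vd.
  rewrite /qform !mulr_sumr -!big_split/=; apply: eq_bigr => i _.
  rewrite !mulr_sumr -!big_split/=; apply: eq_bigr => j _.
  rewrite /k (mulrC (sqdist x i j)); ring.
have [M hM] := qform_gauss_gt0 xinj v0.
apply: (@ge0_Rintegral_gt0 _ _ M) => // t.
  by rewrite kE mulr_ge0 ?expR_ge0// qform_gauss_ge0// expR_ge0.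
move=> /andP[tM _]; rewrite kE mulr_gt0 ?expR_gt0//; apply: hM.
by apply: lt_le_trans (expR_ge1Dx _); lra.
Qed.

End mixtures.

(** * Gaussian integrals and the integrated likelihood *)

Section scalar_mx.
Context {R : realType}.

Definition mxform n (S : 'M[R]_n) (u v : 'cV[R]_n) : R := (u^T *m S *m v) 0 0.

Definition posdef n (S : 'M[R]_n) : Prop := forall v, v != 0 -> 0 < mxform S v v.

Lemma mxformC n (S : 'M[R]_n) u v : S^T = S -> mxform S u v = mxform S v u.
Proof.
move=> Ssym; rewrite /mxform; have <- : (u^T *m S *m v)^T = v^T *m S *m u.
  by rewrite !trmx_mul trmxK Ssym mulmxA.
by rewrite [RHS]mxE.
Qed.

Lemma mxformBl n (S : 'M[R]_n) u v w : mxform S (u - v) w = mxform S u w - mxform S v w.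
Proof. by rewrite /mxform raddfB /= !mulmxBl [LHS]mxE; congr (_ + _); rewrite [LHS]mxE. Qed.

Lemma mxformBr n (S : 'M[R]_n) u v w : mxform S w (u - v) = mxform S w u - mxform S w v.
Proof. by rewrite /mxform mulmxBr [LHS]mxE; congr (_ + _); rewrite [LHS]mxE. Qed.

Lemma mxformZl n (S : 'M[R]_n) b u v : mxform S (b *: u) v = b * mxform S u v.
Proof. by rewrite /mxform linearZ /= -!scalemxAl [LHS]mxE. Qed.

Lemma mxformZr n (S : 'M[R]_n) b u v : mxform S u (b *: v) = b * mxform S u v.
Proof. by rewrite /mxform -scalemxAr [LHS]mxE. Qed.

Lemma mxform_mulmx n m (S : 'M[R]_n) (B : 'M[R]_(n, m)) u v :
  mxform S (B *m u) (B *m v) = mxform (B^T *m S *m B) u v.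
Proof. by rewrite /mxform trmx_mul !mulmxA. Qed.

End scalar_mx.

Section gauss_integral.
Context {R : realType}.
Let mu := @lebesgue_measure R.

(** Completing the square and rescaling to the Gauss integral. *)
Lemma integral_quadratic_gauss (K s a c d : R) : 0 < s -> 0 < a ->
  (\int[mu]_b (K * expR (- (2 * s)^-1 * (a * b ^+ 2 - 2 * c * b + d)))%:E =
   (K * ((2 * pi * s) `^ (2^-1) * a `^ (- 2^-1) *
      expR (- (2 * s)^-1 * (d - c ^+ 2 / a))))%:E)%E.
Proof.
move=> s0 a0; pose al := Num.sqrt (a / (2 * s)).
have as0 : 0 < a / (2 * s) by rewrite divr_gt0// mulr_gt0.
have al0 : 0 < al by rewrite sqrtr_gt0.
have al2 : al ^+ 2 = a / (2 * s) by rewrite sqr_sqrtr// ltW.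
pose ga := - (c / a) * al.
pose e := expR (- (2 * s)^-1 * (d - c ^+ 2 / a)).
have gE b : K * expR (- (2 * s)^-1 * (a * b ^+ 2 - 2 * c * b + d)) =
    (K * e / al) * (gauss_fun (al * b + ga) * al).
  have -> : - (2 * s)^-1 * (a * b ^+ 2 - 2 * c * b + d) =
      - (2 * s)^-1 * (d - c ^+ 2 / a) - (al * b + ga) ^+ 2.
    rewrite /ga (_ : (al * b + - (c / a) * al) ^+ 2 = al ^+ 2 * (b - c / a) ^+ 2); last by ring.
    by rewrite al2; field; rewrite !gt_eqF.
  by rewrite expRD -/e /gauss_fun; field; rewrite gt_eqF.
under eq_integral do rewrite gE EFinM.
have cg := @continuous_gauss_fun R.
have mg : measurable_fun [set: R] (fun b => gauss_fun (al * b + ga) * al).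
  apply: measurable_funM => //; apply: measurableT_comp.
    exact: measurable_gauss_fun.
  by apply: measurable_funD => //; exact: measurable_funM.
have ig : (\int[mu]_b (gauss_fun (al * b + ga) * al)%:E = (Num.sqrt pi)%:E)%E.
  by rewrite -ge0_integral_affine ?integralT_gauss//; exact: gauss_fun_ge0.
rewrite integralZl//; last first.
  apply/integrableP; split; first exact/measurable_EFinP.
  under eq_integral do rewrite /= ger0_norm ?mulr_ge0 ?gauss_fun_ge0 ?(ltW al0)//.
  by rewrite ig ltry.
rewrite ig -EFinM; congr EFin.
have -> : 2 * pi * s = pi * (2 * s) :> R by ring.
have s20 : 0 < 2 * s by rewrite mulr_gt0.
rewrite powRM ?pi_ge0 ?(ltW s20)// powRN !powR12_sqrt ?pi_ge0 ?(ltW s20) ?(ltW a0)// -/e.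
rewrite /al sqrtrM ?(ltW a0)// sqrtrV ?(ltW s20)//.
by field; rewrite !gt_eqF ?sqrtr_gt0.
Qed.

End gauss_integral.

Section gauss_integral_cV.
Context {R : realType}.

Lemma mxform_sub n (S : 'M[R]_n) u v b : S^T = S ->
  mxform S (u - b *: v) (u - b *: v) =
  mxform S v v * b ^+ 2 - 2 * mxform S v u * b + mxform S u u.
Proof.
move=> /(mxformC u v) sym.
by rewrite !(mxformBl, mxformBr, mxformZl, mxformZr) sym; ring.
Qed.

(** Completing the square one coordinate at a time: [A] is the matrix of the
    minimum of the quadratic form over the affine space [u - im H]. *)
Lemma integral_cV_gauss n (P : 'M[R]_n) (s : R) : P^T = P -> 0 < s ->
  forall p (H : 'M[R]_(n, p)), posdef (H^T *m P *m H) ->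
  exists A : 'M[R]_n, [/\ A^T = A, H^T *m A = 0,
    exists X, A = P - P *m H *m X, 0 < \det (H^T *m P *m H) &
    forall K u,
    integral_cV (fun beta => (K * expR (- (2 * s)^-1 *
       mxform P (u - H *m beta) (u - H *m beta)))%:E) =
    (K * ((2 * pi * s) `^ (p%:R / 2) * (\det (H^T *m P *m H)) `^ (- 2^-1) *
      expR (- (2 * s)^-1 * mxform A u u)))%:E].
Proof.
move=> Psym s0; have pis0 : 0 < 2 * pi * s by rewrite !mulr_gt0 ?pi_gt0.
elim=> [|q IH] H Hpos.
  exists P; split=> //.
  - by rewrite [H]thinmx0 trmx0 mul0mx.
  - by exists 0; rewrite mulmx0 subr0.
  - by rewrite det_mx00.
  - move=> K u; rewrite /= det_mx00 powR1 mul0r powRr0 !mul1r.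
    by rewrite mulmx0 subr0.
pose h : 'cV[R]_n := lsubmx (H : 'M[R]_(n, 1 + q)).
pose H' : 'M[R]_(n, q) := rsubmx (H : 'M[R]_(n, 1 + q)).
have HE : H = row_mx h H' :> 'M[R]_(n, 1 + q) by rewrite hsubmxK.
have H'pos : posdef (H'^T *m P *m H').
  move=> v v0; have : col_mx (0 : 'cV[R]_1) v != 0.
    by apply: contra_neq v0 => e; rewrite -(col_mxKd (0 : 'cV[R]_1) v) e linear0.
  move/Hpos; rewrite /mxform HE -!mulmxA (mul_row_col h) mulmx0 add0r !mulmxA.
  by rewrite -trmx_mul (mul_row_col h) mulmx0 add0r trmx_mul.
have [A' [A'sym H'A' [X' A'E] d'0 intA']] := IH H' H'pos.
(* [w] is the component of the column [h] orthogonal to the other columns for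
   the form [P], and [a] is its squared length, the next pivot *)
pose a := mxform A' h h.
pose w := h - H' *m X' *m h.
have Pw : P *m w = A' *m h by rewrite A'E mulmxBl mulmxBr !mulmxA.
have wPw : mxform P w w = a.
  rewrite /mxform -mulmxA Pw /w linearB/= mulmxBl !trmx_mul -!mulmxA.
  by rewrite (mulmxA H'^T) H'A' mul0mx !mulmx0 subr0 /a /mxform !mulmxA.
have a0 : 0 < a.
  rewrite -wPw (_ : w = H *m (col_mx (1%:M : 'M[R]_1) (- (X' *m h)))); last first.
    by rewrite HE (mul_row_col h) mulmx1 mulmxN mulmxA.
  rewrite mxform_mulmx; apply: Hpos.
  apply/eqP => /(congr1 (@usubmx _ 1 q 1)); rewrite col_mxKu linear0.
  by move/matrixP/(_ 0 0)/eqP; rewrite !mxE eqxx oner_eq0.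
have detE : \det (H^T *m P *m H) = a * \det (H'^T *m P *m H').
  (* the column operation that replaces [h] by [w] *)
  pose T : 'M[R]_(1 + q) := block_mx 1%:M 0 (- (X' *m h)) 1%:M.
  have detT : \det T = 1 by rewrite det_lblock !det1 mulr1.
  have HT : (H : 'M[R]_(n, 1 + q)) *m T = row_mx w H'.
    by rewrite HE mul_row_block !mulmx1 mulmx0 add0r mulmxN mulmxA.
  have : \det (T^T *m (H^T *m P *m H) *m T) = \det (H^T *m P *m H).
    by rewrite !det_mulmx det_tr detT mul1r mulr1.
  rewrite !mulmxA -trmx_mul -mulmxA HT => <-.
  rewrite tr_row_mx mul_col_mx mul_col_row.
  have wH : w^T *m P *m H' = 0.
    by rewrite -[P]Psym -trmx_mul Pw trmx_mul A'sym -mulmxA -[A' *m H']trmxK trmx_mul A'sym H'A' trmx0 mulmx0.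
  have Hw : H'^T *m P *m w = 0 by rewrite -mulmxA Pw mulmxA H'A' mul0mx.
  rewrite wH Hw det_ublock det_mx11; congr (_ * _).
  by rewrite -wPw.
(* what remains of the form after minimising over multiples of [h] as well *)
pose A := A' - a^-1 *: (A' *m h *m h^T *m A').
have Asym : A^T = A.
  by rewrite /A raddfB /= linearZ /= !trmx_mul trmxK A'sym !mulmxA.
have AE u : mxform A u u = mxform A' u u - (mxform A' h u) ^+ 2 / a.
  have -> : mxform A u u = mxform A' u u -
      a^-1 * (((A' *m h)^T *m u)^T *m ((A' *m h)^T *m u)) 0 0.
    rewrite {1}/mxform /A mulmxBr mulmxBl [LHS]mxE; congr (_ + _); rewrite [LHS]mxE; congr (- _).
    rewrite -scalemxAr -scalemxAl mxE; congr (_ * _).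
    by rewrite !trmx_mul !trmxK A'sym !mulmxA.
  congr (_ - _); rewrite (trmx_mul A') A'sym mxE big_ord1 mxE -/(mxform A' h u).
  by rewrite -expr2 mulrC.
have hA : h^T *m A = 0.
  rewrite /A mulmxBr -scalemxAr !mulmxA.
  have -> : h^T *m A' *m h = a%:M by rewrite [LHS]mx11_scalar.
  rewrite mul_scalar_mx -scalemxAl scalerA mulVf ?gt_eqF// scale1r.
  by rewrite subrr.
have H'A : H'^T *m A = 0.
  by rewrite /A mulmxBr -scalemxAr !mulmxA H'A' !mul0mx scaler0 subrr.
exists A; split=> //.
- by rewrite HE (tr_row_mx h) (mul_col_mx h^T) hA H'A col_mx0.
- pose Y : 'M[R]_(1, n) := a^-1 *: (h^T *m A').
  exists (col_mx Y (X' - X' *m h *m Y)).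
  rewrite HE -mulmxA (mul_row_col h) /A.
  have -> : a^-1 *: (A' *m h *m h^T *m A') = A' *m h *m Y.
    by rewrite /Y -scalemxAr !mulmxA.
  have -> : A' *m h = P *m h - P *m H' *m X' *m h by rewrite {1}A'E mulmxBl.
  rewrite {1}A'E mulmxBl mulmxDr !mulmxBr !mulmxA.
  rewrite opprB opprD opprB -!addrA; congr (_ + _).
  by rewrite addrCA [RHS]addrCA; congr (_ + _); rewrite addrC.
- by rewrite detE mulr_gt0.
move=> K u.
have -> : integral_cV (fun beta : 'cV[R]_q.+1 => (K * expR (- (2 * s)^-1 *
       mxform P (u - H *m beta) (u - H *m beta)))%:E) =
   (\int[lebesgue_measure]_(b in [set: R])
     (K * ((2 * pi * s) `^ (q%:R / 2) * (\det (H'^T *m P *m H')) `^ (- 2^-1)) *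
      expR (- (2 * s)^-1 * (a * b ^+ 2 - 2 * mxform A' h u * b + mxform A' u u)))%:E)%E.
  rewrite /=; apply: eq_integral => b _.
  have Eb (v : 'cV[R]_q) : u - H *m col_mx (b%:M : 'M[R]_1) v = (u - b *: h) - H' *m v.
    by rewrite HE (mul_row_col h) mul_mx_scalar opprD addrA.
  rewrite -(mxform_sub _ _ _ A'sym) -mulrA -intA'.
  by congr (integral_cV _); apply/funext => v; rewrite Eb.
rewrite integral_quadratic_gauss// -AE; congr EFin.
have -> : (\det (H^T *m P *m H)) `^ (- 2^-1) =
    a `^ (- 2^-1) * (\det (H'^T *m P *m H')) `^ (- 2^-1).
  by rewrite detE powRM ?(ltW a0) ?(ltW d'0).
have -> : q.+1%:R / 2 = q%:R / 2 + 2^-1 :> R by rewrite -natr1 mulrDl mul1r.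
by rewrite (@powRD _ (2 * pi * s)) ?(gt_eqF pis0) ?implybT//; ring.
Qed.

End gauss_integral_cV.

Section posdef.
Context {R : realType}.

Lemma posdef_inj n p (P : 'M[R]_n) (H : 'M[R]_(n, p)) :
  posdef P -> (forall b : 'cV[R]_p, H *m b = 0 -> b = 0) -> posdef (H^T *m P *m H).
Proof.
move=> Ppos Hinj b b0; rewrite -mxform_mulmx; apply: Ppos.
by apply: contra_neq b0; exact: Hinj.
Qed.

(** The elimination of [integral_cV_gauss] with [H] the identity produces the
    determinant as a product of positive pivots. *)
Lemma posdef_det_gt0 n (S : 'M[R]_n) : S^T = S -> posdef S -> 0 < \det S.
Proof.
move=> Ssym Spos; have Spos1 : posdef (1%:M^T *m S *m 1%:M) by rewrite trmx1 mul1mx mulmx1.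
have [A [_ _ _ + _]] := integral_cV_gauss Ssym ltr01 Spos1.
by rewrite trmx1 mul1mx mulmx1.
Qed.

Lemma posdef_unitmx n (S : 'M[R]_n) : S^T = S -> posdef S -> S \in unitmx.
Proof. by move=> Ssym Spos; rewrite unitmxE unitfE gt_eqF// posdef_det_gt0. Qed.

Lemma posdef_invmx n (S : 'M[R]_n) : S^T = S -> posdef S -> posdef (invmx S).
Proof.
move=> Ssym Spos v v0; have Su := posdef_unitmx Ssym Spos.
have vE : v = S *m (invmx S *m v) by rewrite mulKVmx.
rewrite vE mxform_mulmx Ssym mulmxV// mul1mx; apply: Spos.
by apply: contra_neq v0 => e; rewrite vE e mulmx0.
Qed.

(** Eliminating the Gram matrix of [row_mx H W] and of [row_mx (invmx S *m H) W]. *)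
Lemma det_restriction n p m (H : 'M[R]_(n, p)) (W : 'M[R]_(n, m)) :
  n = (p + m)%N -> H^T *m W = 0 -> W^T *m W = 1%:M ->
  exists k : R, 0 <= k /\ forall S : 'M[R]_n, S^T = S -> S \in unitmx ->
    \det (H^T *m invmx S *m H) != 0 ->
    \det S * \det (H^T *m invmx S *m H) = k * \det (W^T *m S *m W).
Proof.
move=> nE; subst n => HW WW; have WH : W^T *m H = 0.
  by rewrite -[W^T *m H]trmxK trmx_mul trmxK HW trmx0.
exists (\det (row_mx H W) ^+ 2); split=> [|S Ssym Su g0]; first exact: sqr_ge0.
set P := invmx S; have Psym : P^T = P by rewrite /P trmx_inv Ssym.
pose Q := row_mx H W; pose K := row_mx (P *m H) W.
have e1 : \det Q * \det K = \det (H^T *m P *m H).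
  rewrite -det_tr -det_mulmx tr_row_mx mul_col_row !mulmxA HW WW.
  by rewrite det_lblock det1 mulr1.
have e2 : \det K ^+ 2 * \det S = \det (H^T *m P *m H) * \det (W^T *m S *m W).
  rewrite expr2 -mulrA (mulrC _ (\det S)) mulrA -[in X in X * _ * _]det_tr -!det_mulmx.
  rewrite tr_row_mx mul_col_mx mul_col_row trmx_mul Psym !mulmxA.
  by rewrite !(mulmxKV Su) HW (mulmxK Su) WH det_lblock.
set g := \det (H^T *m P *m H) in g0 e1 e2 *.
apply: (mulfI g0); move: e1 e2.
rewrite -/Q; move: (\det Q) (\det K) (\det S) (\det (W^T *m S *m W)) => q k s d e1 e2.
have -> : g * (s * g) = q ^+ 2 * (k ^+ 2 * s) by rewrite -e1; ring.
by rewrite e2; ring.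
Qed.

(** The columns of [W] span the kernel of [H^T], which contains the columns of
    any [A] with [H^T *m A = 0]. *)
Lemma projection_restriction n p m (H : 'M[R]_(n, p)) (W : 'M[R]_(n, m))
    (S A : 'M[R]_n) (X : 'M[R]_(p, n)) :
  n = (p + m)%N -> \rank H = p -> H^T *m W = 0 -> W^T *m W = 1%:M ->
  S \in unitmx -> W^T *m S *m W \in unitmx ->
  A = invmx S - invmx S *m H *m X -> H^T *m A = 0 ->
  A = W *m invmx (W^T *m S *m W) *m W^T.
Proof.
move=> nE rH HW WW Su Mu AE HA.
have WH : W^T *m H = 0 by rewrite -[W^T *m H]trmxK trmx_mul trmxK HW trmx0.
have Wker : (W^T :=: kermx H)%MS.
  apply/eqmxP; rewrite -(geq_leqif (mxrank_leqif_eq _)); last exact/sub_kermxP.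
  rewrite mxrank_ker rH; have -> : (n - p = m)%N by rewrite nE addKn.
  have : \rank (W^T *m W) = m by rewrite WW mxrank1.
  by move=> {1}<-; exact: mxrankM_maxl.
have /submxP[C CE] : (A^T <= W^T)%MS.
  by rewrite Wker; apply/sub_kermxP; rewrite -[A^T *m H]trmxK trmx_mul trmxK HA trmx0.
have AW : A = W *m C^T by rewrite -[A]trmxK CE trmx_mul trmxK.
have : W^T *m S *m A = W^T.
  rewrite AE mulmxBr !mulmxA -(mulmxA W^T S) mulmxV// mulmx1 WH mul0mx subr0.
  by [].
rewrite AW mulmxA => e; rewrite -mulmxA; congr (_ *m _).
by rewrite -{2}e mulKmx.
Qed.

End posdef.

Section integrated_likelihood.
Context {R : realType}.
Let mu := @lebesgue_measure R.

(** The substitution [t = ln (Q / s)] leads to Euler's integral. *)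
Lemma integral_inverse_gamma (K al Q : R) : 0 < al -> 0 < Q ->
  (\int[mu]_(s in `]0%R, +oo[) (K * (s `^ (- al) * expR (- (Q / s)) * s^-1))%:E =
   (K * (Q `^ (- al) * Gamma al))%:E)%E.
Proof.
move=> al0 Q0; pose G t := expR (- (al * t) - Q * expR (- t)).
have cG : continuous G by rewrite /G; continuity.
have G0 t : 0 <= G t := expR_ge0 _.
have cGN : continuous (fun t => G (- t)) by rewrite /G; continuity.
have GE t : G (- (1 * t - ln Q)) * 1 = Q `^ (- al) * gw al t.
  rewrite mulr1 mul1r /G opprK powR_expR// -expRD.
  by rewrite (expRD t) expRN lnK ?posrE// mulrCA divff ?gt_eqF// mulr1; congr expR; ring.
have gi := integrable_gw al0.
have intG : (\int[mu]_t (G t)%:E = (Q `^ (- al) * Gamma al)%:E)%E.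
  rewrite (ge0_integral_opp (continuous_measurable_fun cG) G0).
  rewrite (@ge0_integral_affine _ _ _ (- ln Q) ltr01 cGN (fun t => G0 _)).
  under eq_integral do rewrite GE EFinM.
  rewrite (integralZl measurableT gi) [RHS]EFinM GammaE; congr (_ * _)%E.
  by rewrite /Rintegral fineK//; exact: (integrable_fin_num measurableT gi).
have GlnE s : `]0, +oo[%classic s -> G (ln s) * s^-1 = s `^ (- al) * expR (- (Q / s)) * s^-1.
  rewrite /= in_itv/= andbT => s0; congr (_ * _).
  by rewrite /G (expRN (ln s)) lnK ?posrE// expRD powR_expR// mulNr.
under eq_integral => s /set_mem s0 do rewrite -GlnE// EFinM.
have iG : mu.-integrable [set: R] (EFin \o G).
  apply/integrableP; split.
    by apply/measurable_EFinP; exact: (continuous_measurable_fun cG).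
  by under eq_integral do rewrite /= ger0_norm//; rewrite intG ltry.
have Gi := integrable_exp_subst cG G0 iG.
by rewrite (integralZl _ Gi)// -ge0_integral_exp// intG EFinM.
Qed.

Lemma posdef1 n : posdef (1%:M : 'M[R]_n).
Proof.
move=> v /cV0Pn[i vi].
rewrite /mxform mulmx1 mxE (bigD1 i)//= mxE -expr2 ltr_pwDl ?exprn_even_gt0//.
by apply: sumr_ge0 => j _; rewrite mxE -expr2 sqr_ge0.
Qed.

(** The integral over the coefficients leaves an inverse gamma integral in the
    variance. The order of the quantifiers matters: [k] is common to all
    covariance matrices, hence does not depend on the range parameter. *)
Lemma integrated_likelihood_closed n p m (H : 'M[R]_(n, p)) (W : 'M[R]_(n, m)) :
  n = (p + m)%N -> (0 < m)%N -> \rank H = p -> H^T *m W = 0 -> W^T *m W = 1%:M ->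
  exists k : R, 0 < k /\ forall (S : 'M[R]_n) (y : 'cV[R]_n),
    S^T = S -> posdef S -> W^T *m y != 0 ->
    (\int[mu]_(s in `]0%R, +oo[)
       (integral_cV (fun beta : 'cV[R]_p =>
          (gaussian_density S s (y - H *m beta))%:E) * (s^-1)%:E) =
     (k * ((\det (W^T *m S *m W)) `^ (- 2^-1) *
       (mxform (invmx (W^T *m S *m W)) (W^T *m y) (W^T *m y)) `^ (- (m%:R / 2))))%:E)%E.
Proof.
move=> nE m0 rH HW WW.
have Hinj (b : 'cV[R]_p) : H *m b = 0 -> b = 0.
  move=> /(congr1 trmx); rewrite trmx_mul trmx0 => e.
  apply: trmx_inj; rewrite trmx0; apply: (row_free_inj (A := H^T)).
    by rewrite /row_free mxrank_tr rH.
  by rewrite e mul0mx.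
have Winj (b : 'cV[R]_m) : W *m b = 0 -> b = 0.
  by move=> e; rewrite -[b]mul1mx -WW -mulmxA e mulmx0.
have Hpos (P : 'M[R]_n) : P^T = P -> posdef P -> 0 < \det (H^T *m P *m H).
  move=> Psym Ppos; apply: posdef_det_gt0; last exact: posdef_inj.
  by rewrite !trmx_mul trmxK Psym mulmxA.
have [k [k0 kE]] := det_restriction nE HW WW.
have m20 : 0 < m%:R / 2 :> R by rewrite divr_gt0// ltr0n.
have kgt0 : 0 < k.
  rewrite lt_neqAle k0 andbT eq_sym; apply/eqP => k00.
  have g0 := Hpos _ (trmx1 _ _) (@posdef1 n).
  have := kE _ (trmx1 _ _) (unitmx1 _ _); rewrite invmx1 k00 mul0r det1 mul1r.
  by move=> /(_ (lt0r_neq0 g0))/eqP; rewrite gt_eqF.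
exists ((2 * pi) `^ (- (m%:R / 2)) * k `^ (- 2^-1) * (2^-1) `^ (- (m%:R / 2)) * Gamma (m%:R / 2)).
have pi20 : 0 < 2 * pi :> R by rewrite mulr_gt0 ?pi_gt0.
split.
  by rewrite mulr_gt0 ?Gamma_gt0// mulr_gt0 ?powR_gt0// mulr_gt0 ?powR_gt0.
move=> S y Ssym Spos z0.
have Su := posdef_unitmx Ssym Spos.
set M := W^T *m S *m W; set z := W^T *m y.
have Msym : M^T = M by rewrite /M !trmx_mul trmxK Ssym mulmxA.
have Mpos : posdef M by exact: posdef_inj.
have Mu := posdef_unitmx Msym Mpos.
have d0 := posdef_det_gt0 Msym Mpos.
pose P := invmx S; have Psym : P^T = P by rewrite /P trmx_inv Ssym.
have Ppos : posdef P by exact: posdef_invmx.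
have g0 := Hpos _ Psym Ppos.
have HPpos : posdef (H^T *m P *m H) by exact: posdef_inj.
pose Q := mxform (invmx M) z z.
have Q0 : 0 < Q by apply: posdef_invmx.
have detE := kE _ Ssym Su (lt0r_neq0 g0).
have dS0 := posdef_det_gt0 Ssym Spos.
have inner s : `]0, +oo[%classic s ->
    (integral_cV (fun beta : 'cV[R]_p =>
          (gaussian_density S s (y - H *m beta))%:E) * (s^-1)%:E =
     ((2 * pi) `^ (- (m%:R / 2)) * (k * \det M) `^ (- 2^-1) *
       (s `^ (- (m%:R / 2)) * expR (- (Q / 2 / s)) * s^-1))%:E)%E.
  rewrite /= in_itv/= andbT => s0.
  have [A [_ HA [X AE] _ intA]] := integral_cV_gauss Psym s0 HPpos.
  have AWE := projection_restriction nE rH HW WW Su Mu AE HA.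
  have AQ : mxform A y y = Q.
    by rewrite AWE /Q /z mxform_mulmx trmxK.
  rewrite [X in (X * _)%E]intA AQ -EFinM; congr EFin.
  have pis0 : 0 < 2 * pi * s by rewrite mulr_gt0.
  have -> : - (2 * s)^-1 * Q = - (Q / 2 / s) by rewrite invfM; ring.
  have -> : (k * \det M) `^ (- 2^-1) = (\det S) `^ (- 2^-1) * (\det (H^T *m P *m H)) `^ (- 2^-1).
    by rewrite -detE powRM// ltW.
  have e : (2 * pi) `^ (- (m%:R / 2)) * s `^ (- (m%:R / 2)) =
      (2 * pi * s) `^ (- (n%:R / 2)) * (2 * pi * s) `^ (p%:R / 2).
    rewrite -powRM ?(ltW pi20) ?(ltW s0)// -powRD ?(gt_eqF pis0) ?implybT//.
    by congr (_ `^ _); rewrite nE natrD; field.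
  set E := expR _; set dS := _ `^ (- 2^-1); set g := (\det (H^T *m P *m H)) `^ _.
  transitivity ((2 * pi * s) `^ (- (n%:R / 2)) * (2 * pi * s) `^ (p%:R / 2) * (dS * g * E * s^-1)).
    by ring.
  by rewrite -e; ring.
transitivity (\int[mu]_(s in `]0%R, +oo[) ((2 * pi) `^ (- (m%:R / 2)) *
    (k * \det M) `^ (- 2^-1) * (s `^ (- (m%:R / 2)) * expR (- (Q / 2 / s)) * s^-1))%:E)%E.
  by apply: eq_integral => s /set_mem; exact: inner.
rewrite integral_inverse_gamma ?divr_gt0 ?ltr0n//; congr EFin.
have h20 : 0 <= 2^-1 :> R by rewrite invr_ge0.
by rewrite (powRM _ (ltW kgt0) (ltW d0)) (powRM _ (ltW Q0) h20) -/Q; ring.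
Qed.

End integrated_likelihood.

(** * Limits of matrices and integrability on a half-line *)

Section matrix_limits.
Context {R : realType} {T : Type} (F : set_system T) {FF : Filter F}.

Lemma cvg_det m (A : T -> 'M[R]_m) (L : 'M[R]_m) :
  (forall i j, A t i j @[t --> F] --> L i j) -> \det (A t) @[t --> F] --> \det L.
Proof.
move=> AL; apply: cvg_sumr => s _; apply: cvgM; first exact: cvg_cst.
by apply: cvg_prodr => i _; exact: AL.
Qed.

Lemma cvg_adj m (A : T -> 'M[R]_m) (L : 'M[R]_m) i j :
  (forall i j, A t i j @[t --> F] --> L i j) ->
  (\adj (A t)) i j @[t --> F] --> (\adj L) i j.
Proof.
move=> AL; rewrite mxE; under eq_fun do rewrite mxE.
apply: cvgM; first exact: cvg_cst.
by apply: cvg_det => a b; rewrite !mxE; under eq_fun do rewrite !mxE; exact: AL.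
Qed.

Lemma cvg_mulmx m n p (A : T -> 'M[R]_(m, n)) (B : T -> 'M[R]_(n, p))
    (LA : 'M[R]_(m, n)) (LB : 'M[R]_(n, p)) :
  (forall i j, A t i j @[t --> F] --> LA i j) ->
  (forall i j, B t i j @[t --> F] --> LB i j) ->
  forall i j, (A t *m B t) i j @[t --> F] --> (LA *m LB) i j.
Proof.
move=> AL BL i j; rewrite mxE; under eq_fun do rewrite mxE.
by apply: cvg_sumr => k _; apply: cvgM; [exact: AL|exact: BL].
Qed.

Lemma cvg_mxtrace m (A : T -> 'M[R]_m) (L : 'M[R]_m) :
  (forall i j, A t i j @[t --> F] --> L i j) -> \tr (A t) @[t --> F] --> \tr L.
Proof. by move=> AL; apply: cvg_sumr => i _; exact: AL. Qed.

(** Cramer's formula; the determinant is eventually nonzero. *)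
Lemma cvg_invmx m (A : T -> 'M[R]_m) (L : 'M[R]_m) : L \in unitmx ->
  (forall i j, A t i j @[t --> F] --> L i j) ->
  forall i j, (invmx (A t)) i j @[t --> F] --> (invmx L) i j.
Proof.
move=> Lu AL i j; have dL : \det L != 0 by move: Lu; rewrite unitmxE unitfE.
have dA := cvg_det AL.
have : (\det (A t))^-1 * (\adj (A t)) i j @[t --> F] --> (invmx L) i j.
  rewrite /invmx Lu [X in _ --> X]mxE; apply: cvgM; last exact: cvg_adj.
  exact: cvgV.
apply: cvg_trans; apply: near_eq_cvg.
have : \forall t \near F, \det (A t) != 0 by exact: cvgr_neq0 dA dL.
by apply: filterS => t dAt; rewrite /invmx unitmxE unitfE dAt [RHS]mxE.
Qed.

End matrix_limits.

Section prior_of.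
Context {R : realType}.

(** Separates the prior from the way in which its two matrices, the derivative
    [D] and the covariance [M], depend on the range parameter. *)
Definition prior_of m (D M : 'M[R]_m) : R :=
  let B := D *m invmx M in
  Num.sqrt (\tr (B *m B) - (m%:R)^-1 * (\tr B) ^+ 2).

Lemma cvg_prior_of (T : Type) (F : set_system T) (FF : Filter F) m
    (D M : T -> 'M[R]_m) (LD LM : 'M[R]_m) : LM \in unitmx ->
  (forall i j, D t i j @[t --> F] --> LD i j) ->
  (forall i j, M t i j @[t --> F] --> LM i j) ->
  prior_of (D t) (M t) @[t --> F] --> prior_of LD LM.
Proof.
move=> Mu cD cM; have cI := @cvg_invmx _ _ F FF _ _ _ Mu cM.
have cB := @cvg_mulmx _ _ F FF _ _ _ _ _ _ _ cD cI.
rewrite /prior_of /=; apply: continuous_cvg; first exact: sqrt_continuous.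
have ctr := @cvg_mxtrace _ _ F FF _ _ _ cB.
have ctr2 := @cvg_mxtrace _ _ F FF _ _ _ (@cvg_mulmx _ _ F FF _ _ _ _ _ _ _ cB cB).
apply: (@cvgB _ R^o); first exact: ctr2.
apply: cvgM; first exact: cvg_cst.
rewrite expr2; under eq_fun do rewrite expr2.
by apply: cvgM; exact: ctr.
Qed.

(** The prior only sees the trace-free part of the logarithmic derivative, hence
    does not depend on a scalar factor of the covariance. *)
Lemma prior_of_scale m (D M : 'M[R]_m) (a c : R) : (0 < m)%N -> M \in unitmx ->
  c != 0 -> prior_of (a *: (c *: M) + c *: D) (c *: M) = prior_of D M.
Proof.
move=> m0 Mu c0; have mR : m%:R != 0 :> R by rewrite pnatr_eq0 -lt0n.
have cinv : invmx (c *: M) = c^-1 *: invmx M by rewrite invmxZ ?unitmxZ ?unitfE.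
rewrite /prior_of; set B := D *m invmx M.
have -> : (a *: (c *: M) + c *: D) *m invmx (c *: M) = a%:M + B.
  rewrite cinv mulmxDl -!scalemxAl -!scalemxAr !scalerA mulmxV//.
  by rewrite mulfK// mulfV// scale1r scalemx1.
congr Num.sqrt.
rewrite mulmxDl !mulmxDr mul_scalar_mx !mxtraceD mul_mx_scalar mul_scalar_mx !mxtraceZ mxtrace_scalar.
by rewrite -mulr_natr; field.
Qed.

(** The subtracted square can be dropped; the trace of a square is then bounded
    entry by entry. *)
Lemma prior_of_le m (D M : 'M[R]_m) (d k : R) : 0 <= d -> 0 <= k ->
  (forall i j, `|D i j| <= d) -> (forall i j, `|invmx M i j| <= k) ->
  prior_of D M <= m%:R * (m%:R * (d * k)).
Proof.
move=> d0 k0 Dd Mk; rewrite /prior_of; set B := D *m invmx M.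
pose b := m%:R * (d * k).
have b0 : 0 <= b by rewrite !mulr_ge0.
have sum_le (f : 'I_m -> R) (e : R) : (forall i, `|f i| <= e) -> `|\sum_i f i| <= m%:R * e.
  move=> fe; apply: (le_trans (ler_norm_sum _ _ _)).
  apply: (@le_trans _ _ (\sum_(i < m) e)); first exact: ler_sum.
  by rewrite sumr_const card_ord mulr_natl.
have Bb i j : `|B i j| <= b.
  by rewrite mxE; apply: (sum_le _ _) => l; rewrite normrM ler_pM.
have tB : \tr (B *m B) <= (m%:R * b) ^+ 2.
  apply: (le_trans (ler_norm _)); rewrite exprMn expr2 -mulrA.
  apply: (sum_le _ _) => i; rewrite mxE; apply: (sum_le _ _) => j.
  by rewrite normrM expr2 ler_pM.
apply: (@le_trans _ _ (Num.sqrt ((m%:R * b) ^+ 2))).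
  apply: ler_wsqrtr; apply: le_trans tB.
  by rewrite gerBl mulr_ge0 ?sqr_ge0// invr_ge0.
by rewrite sqrtr_sqr ger0_norm// mulr_ge0.
Qed.

Lemma prior_of_ge0 m (D M : 'M[R]_m) : 0 <= prior_of D M.
Proof. exact: sqrtr_ge0. Qed.

End prior_of.

Section half_line.
Context {R : realType}.
Let mu := @lebesgue_measure R.

(** The dominating function is a multiple of [expR (- (b * |ln x|)) / x], which is
    integrable for every [b > 0] by the change of variable [t = ln x] and which
    for small [b] bounds, up to a factor, constants near 0 and [x `^ (- p)] near
    infinity. *)
Lemma integrable_half_line (f : R -> R) (p C l : R) : 1 < p ->
  {in `]0, +oo[, continuous f} -> f x @[x --> 0^'+] --> l ->
  (\forall x \near +oo, `|f x| <= C * x `^ (- p)) ->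
  mu.-integrable `]0%R, +oo[ (EFin \o f).
Proof.
move=> p1 cf f0 [T0 [_ fT]].
have l1 : `|l| < `|l| + 1 by rewrite ltrDl.
have := cvgr_norm_lt _ f0 _ l1; rewrite /prop_near1 => -[a /= a0 fa].
have {}fa x : 0 < x < a -> `|f x| <= `|l| + 1.
  move=> /andP[x0 xa]; apply: ltW; apply: fa => //=.
  by rewrite sub0r normrN gtr0_norm.
pose a' := a / 2; have a'0 : 0 < a' by rewrite divr_gt0.
have a'a : a' < a by rewrite /a'; lra.
pose T := Num.max (T0 + 1) (a' + 1).
have TT0 : T0 < T by rewrite lt_max ltrDl ltr01.
have Ta : a' <= T by rewrite le_max lerDl ler01 orbT.
have T_gt0 : 0 < T by exact: lt_le_trans Ta.
have cfn : {within `[a', T], continuous (fun x => `|f x|)}.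
  apply: continuous_in_subspaceT => x; rewrite inE/= in_itv/= => /andP[ax _].
  apply: (@continuous_comp _ _ _ f (fun y => `|y|)); last exact: norm_continuous.
  by apply: cf; rewrite in_itv/= andbT (lt_le_trans a'0).
have [c _ fc] := EVT_max Ta cfn.
pose K := Num.max (`|l| + 1) `|f c|.
have K0 : 0 < K by rewrite lt_max ltr_wpDl.
have fK x : 0 < x <= T -> `|f x| <= K.
  move=> /andP[x0 xT]; rewrite le_max; have [xa|xa] := ltP x a'.
    by rewrite fa// x0 (lt_trans xa).
  by rewrite fc ?orbT// in_itv/= xa.
(* [b <= p - 1] serves the decay at infinity, [b <= 1] the bound near 0 *)
pose b := Num.min (p - 1) 1.
have b0 : 0 < b by rewrite lt_min subr_gt0 p1 ltr01.
have bp : b <= p - 1 by rewrite ge_min lexx.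
have b1 : b <= 1 by rewrite ge_min lexx orbT.
pose G (t : R) := expR (- (b * `|t|)).
have cG : continuous G.
  apply: continuous_fun_expR; apply: continuous_funN.
  by apply: continuous_funM; [exact: continuous_fun_cst|exact: norm_continuous].
have iG := integrable_exp_subst cG (fun t => expR_ge0 _) (integrable_expRN_norm b0).
have C0 : 0 <= C.
  have /fT : T0 < T by [].
  by rewrite -(pmulr_lge0 _ (powR_gt0 (- p) T_gt0)); exact: le_trans.
have G1 x : 1 <= x -> x `^ (- p) <= G (ln x) * x^-1.
  move=> x1; have x0 : 0 < x by exact: lt_le_trans x1.
  rewrite powR_expR// /G ger0_norm ?ln_ge0// -[in X in _ / X](@lnK _ x) ?posrE//.
  rewrite -expRN -expRD ler_expR; have := ln_ge0 x1; nra.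
pose k := expR (- ((1 + b) * `|ln T|)).
have Gk x : 0 < x <= T -> k <= G (ln x) * x^-1.
  move=> /andP[x0 xT]; rewrite /G -[in X in _ / X](@lnK _ x) ?posrE//.
  rewrite -expRN -expRD ler_expR.
  have lnxT : ln x <= `|ln T|.
    by apply: le_trans (ler_norm _); rewrite ler_ln ?posrE.
  have [l0|l0] := leP 0 (ln x).
    rewrite (ger0_norm l0); nra.
  have := normr_ge0 (ln T); rewrite (ltr0_norm l0); nra.
have k0 : 0 < k := expR_gt0 _.
have iKG : mu.-integrable `]0%R, +oo[
    (fun x => ((K / k + C)%:E * (EFin \o (fun s : R => (G (ln s) / s)%R)) x)%E).
  by apply: integrableZl.
apply: le_integrable iKG => //.
  apply/measurable_EFinP; apply: open_continuous_measurable_fun; first exact: interval_open.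
  by move=> x; rewrite inE; exact: cf.
move=> x /=; rewrite in_itv/= andbT => x0; rewrite lee_fin.
apply: le_trans (ler_norm _).
have Gx0 : 0 <= G (ln x) / x by rewrite mulr_ge0 ?expR_ge0// invr_ge0 ltW.
rewrite mulrDl; have [xT|xT] := leP x T.
  apply: ler_wpDr; first by rewrite mulr_ge0.
  apply: (@le_trans _ _ K); first by rewrite fK// x0.
  rewrite -mulrA ler_peMr ?(ltW K0)//.
  by rewrite mulrC ler_pdivlMr// mul1r Gk// x0.
apply: ler_wpDl; first by rewrite mulr_ge0// divr_ge0 ?(ltW K0) ?(ltW k0).
apply: (le_trans (fT _ (lt_trans TT0 xT))); rewrite ler_wpM2l// G1//.
apply: le_trans (ltW xT); rewrite le_max.
by apply/orP; right; rewrite lerDr ltW.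
Qed.

End half_line.

(** * The correlation as a function of the range parameter *)

Section scaled_derivatives.
Context {R : realType}.
Implicit Types (nu q theta c : R).

Lemma is_derive_sumr (I : Type) (s : seq I) (f : I -> R -> R) (df : I -> R) (t : R) :
  (forall i, is_derive t 1 (f i) (df i)) ->
  is_derive t 1 (fun t => \sum_(i <- s) f i t) (\sum_(i <- s) df i).
Proof.
move=> fd; elim: s => [|i s IH].
  rewrite big_nil (_ : (fun t => _) = cst 0); first exact: is_derive_cst.
  by apply/funext => u; rewrite big_nil.
rewrite big_cons (_ : (fun t => _) = f i + (fun t => \sum_(i <- s) f i t)).
  exact: is_deriveD.
by apply/funext => u; rewrite big_cons.
Qed.

Lemma is_derive_lap_scaled (w : R -> R) c theta : lap_weight w -> 0 < c -> 0 < theta ->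
  is_derive theta 1 (fun t => lap w (c / t ^+ 2))
    (2 * c / theta ^+ 3 * lap (fun t => w t * expR (- t)) (c / theta ^+ 2)).
Proof.
move=> ww c0 t0; have tn0 : theta ^+ 2 != 0 by rewrite expf_eq0/= gt_eqF.
have l0 : 0 < c / theta ^+ 2 by rewrite divr_gt0// exprn_gt0.
have dl := is_derive_lap ww l0.
have dg : is_derive theta 1 (fun t : R => c / t ^+ 2) (- (2 * c / theta ^+ 3)).
  have d2 : is_derive theta 1 (fun t : R => t ^+ 2) (2 * theta).
    by apply: is_derive_eq; rewrite /GRing.scale/=; ring.
  have dV := @is_deriveV _ (fun t : R => t ^+ 2) theta (2 * theta) 1 tn0 d2.
  apply: is_derive_eq.
  rewrite /GRing.scale/=; field.
  by rewrite gt_eqF.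
have := @is_derive1_comp _ (lap w) (fun t : R => c / t ^+ 2) theta _ _ dl dg.
by move=> h; apply: is_derive_eq; ring.
Qed.

(** The correlation and its derivative in [theta], then the rescaled remainder
    of its affine expansion in [q] and the derivative of that remainder, as
    functions of the range [theta] and of the squared distance [q]. *)
Definition kmat nu theta q : R := lap (gw nu) (nu * q / theta ^+ 2) / Gamma nu.

Definition dkmat nu theta q : R :=
  2 * (nu * q) / theta ^+ 3 * lap (gw (nu - 1)) (nu * q / theta ^+ 2) / Gamma nu.

Definition rmat nu theta q : R :=
  (nu * q) `^ nu * lap (affine_rem nu) (nu * q / theta ^+ 2) / Gamma nu.

Definition drmat nu theta q : R :=
  (nu * q) `^ nu * (2 * (nu * q) / theta ^+ 3 *
    lap (fun t => affine_rem nu t * expR (- t)) (nu * q / theta ^+ 2)) / Gamma nu.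

Lemma is_derive_kmat nu theta q : 0 < nu -> 0 <= q -> 0 < theta ->
  is_derive theta 1 (kmat nu ^~ q) (dkmat nu theta q).
Proof.
move=> nu0; rewrite le_eqVlt => /predU1P[<-|q0] t0.
  rewrite /dkmat !(mulr0, mul0r) (_ : kmat nu ^~ 0 = cst (lap (gw nu) 0 / Gamma nu)).
    exact: is_derive_cst.
  by apply/funext => u; rewrite /kmat mulr0 mul0r.
have ww : lap_weight (gw nu).
  by apply: integrable_lap_weight; [exact: integrable_gw|move=> t; exact/ltW/gw_gt0].
have := is_derive_lap_scaled ww (mulr_gt0 nu0 q0) t0.
rewrite (_ : (fun t => gw nu t * expR (- t)) = gw (nu - 1)); last exact/funext/gw_shift.
move=> /(is_deriveZ (Gamma nu)^-1); rewrite (_ : _ \*: _ = kmat nu ^~ q).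
  by move=> h; apply: is_derive_eq; rewrite /dkmat /GRing.scale/= mulrC.
by apply/funext => u; rewrite /kmat /= /GRing.scale/= mulrC.
Qed.

Lemma is_derive_rmat nu theta q : 1 < nu < 2 -> 0 <= q -> 0 < theta ->
  is_derive theta 1 (rmat nu ^~ q) (drmat nu theta q).
Proof.
move=> nu12; have nu0 : 0 < nu by case/andP: nu12 => *; lra.
rewrite le_eqVlt => /predU1P[<-|q0] t0.
  have p0 : (0 : R) `^ nu = 0 by rewrite powR0// gt_eqF.
  rewrite /drmat mulr0 p0 !mul0r (_ : rmat nu ^~ 0 = cst 0); first exact: is_derive_cst.
  by apply/funext => u; rewrite /rmat mulr0 p0 !mul0r.
have ww : lap_weight (affine_rem nu).
  by apply: integrable_lap_weight; [exact: integrable_affine_rem|exact: affine_rem_ge0].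
have := is_derive_lap_scaled ww (mulr_gt0 nu0 q0) t0.
move=> /(is_deriveZ ((nu * q) `^ nu / Gamma nu)); rewrite (_ : _ \*: _ = rmat nu ^~ q).
  by move=> h; apply: is_derive_eq; rewrite /drmat /GRing.scale/=; ring.
by apply/funext => u; rewrite /rmat /=/GRing.scale/=; ring.
Qed.

Lemma powR_sqr_inv theta nu : 0 < theta -> (theta ^+ 2)^-1 `^ nu = theta `^ (- (2 * nu)).
Proof.
move=> t0; have t20 : 0 < theta ^+ 2 by rewrite exprn_gt0.
rewrite !powR_expR ?invr_gt0// lnV ?posrE// lnXn// -mulr_natl; congr expR; ring.
Qed.

Lemma kmat_expansion nu theta q : 1 < nu < 2 -> 0 <= q -> 0 < theta ->
  kmat nu theta q = 1 + - (nu * Gamma (nu - 1) / Gamma nu / theta ^+ 2) * q +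
    theta `^ (- (2 * nu)) * rmat nu theta q.
Proof.
move=> nu12; have nu0 : 0 < nu by case/andP: nu12 => *; lra.
have G0 : Gamma nu != 0 by rewrite gt_eqF// Gamma_gt0.
rewrite /kmat /rmat le_eqVlt => /predU1P[<-|q0] t0.
  by rewrite !(mulr0, mul0r) powR0 ?gt_eqF// !(mulr0, mul0r) lap0E -GammaE divff// !addr0.
have t20 : 0 < theta ^+ 2 by rewrite exprn_gt0.
have nq0 : 0 < nu * q by rewrite mulr_gt0.
have l0 : 0 < nu * q / theta ^+ 2 by rewrite divr_gt0.
rewrite lap_gw_expansion// [in X in _ + X](powRM _ (ltW nq0)) ?invr_ge0 ?(ltW t20)//.
rewrite powR_sqr_inv//; set L := lap _ _; set P := powR _ _; set P' := powR _ _.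
move: L P P' (Gamma (nu - 1)) (Gamma nu) G0 (gt_eqF t0) => L P P' G1 G G0 tn0.
by field; rewrite G0 tn0.
Qed.

(** With [l = nu * q / theta ^+ 2], the factor [theta ^- 3] from the chain rule
    and the rate [l `^ (1 - nu)] multiply to [theta ^ (2 (nu - 1) - 3)]. *)
Lemma drmat_le nu q : 1 < nu < 2 -> 0 <= q ->
  exists2 C, 0 <= C & forall theta, 0 < theta ->
    `|drmat nu theta q| <= C * theta `^ (- 2 * (2 - nu) - 1).
Proof.
move=> nu12; have nu0 : 0 < nu by case/andP: nu12 => *; lra.
have nu10 : 0 < nu - 1 by case/andP: nu12 => *; lra.
rewrite le_eqVlt => /predU1P[<-|q0].
  by exists 0 => // t t0; rewrite /drmat !(mulr0, mul0r) normr0.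
have nq0 : 0 < nu * q by rewrite mulr_gt0.
have := lap_affine_rem_shift_le nu12; rewrite /drmat.
move: (Gamma nu) (Gamma (nu - 1)) (Gamma_gt0 nu0) (Gamma_gt0 nu10) => G G1 G0 G10 Lle.
exists ((nu * q) `^ nu * (2 * (nu * q) * ((nu * q) `^ (1 - nu) * G1)) / G).
  apply: divr_ge0; last exact: (ltW G0).
  by apply: mulr_ge0; rewrite ?powR_ge0// !mulr_ge0 ?powR_ge0 ?(ltW nu0) ?(ltW q0) ?(ltW G10).
move=> theta t0; have t20 : 0 < theta ^+ 2 by rewrite exprn_gt0.
have l0 : 0 < nu * q / theta ^+ 2 by rewrite divr_gt0.
move: (Lle _ l0).
have := @lap_ge0 _ (fun t => affine_rem nu t * expR (- t)) (nu * q / theta ^+ 2).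
move: (lap _ _) => L L0 {}Lle.
have {}L0 : 0 <= L by apply: L0 => t; rewrite mulr_ge0 ?affine_rem_ge0 ?expR_ge0.
have t3 : theta `^ (- 2 * (2 - nu) - 1) = theta `^ (- (2 * (1 - nu))) / theta ^+ 3.
  rewrite -[theta ^+ 3]powR_mulrn ?ltW// -powRN -powRD ?(gt_eqF t0) ?implybT//.
  by congr (_ `^ _); ring.
rewrite powRM ?(ltW nq0) ?invr_ge0 ?(ltW t20)// powR_sqr_inv// in Lle.
have c30 : 0 < (theta ^+ 3)^-1 by rewrite invr_gt0 exprn_gt0.
rewrite ger0_norm; last first.
  apply: divr_ge0; last exact: (ltW G0).
  by rewrite mulr_ge0 ?powR_ge0// mulr_ge0// mulr_ge0 ?(ltW c30)// mulr_ge0// ltW.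
rewrite t3; move: Lle; set a := (nu * q) `^ (1 - nu); set e := theta `^ _ => Lle.
apply: (@le_trans _ _ ((nu * q) `^ nu * (2 * (nu * q) / theta ^+ 3 * (a * e * G1)) / G)).
  rewrite ler_wpM2r ?invr_ge0 ?(ltW G0)// ler_wpM2l ?powR_ge0// ler_wpM2l//.
  by rewrite !mulr_ge0// ltW.
by rewrite le_eqVlt; apply/orP; left; apply/eqP; ring.
Qed.

Lemma cvg_sqr_invr_y c : c / theta ^+ 2 @[theta --> +oo] --> 0.
Proof.
rewrite -[X in _ --> X](mulr0 c); apply: cvgM; first exact: cvg_cst.
apply: (@cvg_comp _ _ _ (fun t : R => t ^+ 2) (fun t => t^-1)); last exact: cvg_invr_y.
exact: cvgr_expr2.
Qed.

Lemma cvg_rmat nu q : 1 < nu < 2 -> 0 <= q ->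
  rmat nu theta q @[theta --> +oo] -->
    (nu * q) `^ nu * (\int[lebesgue_measure]_t affine_rem nu t) / Gamma nu.
Proof.
move=> nu12 q0; have nu0 : 0 < nu by case/andP: nu12 => *; lra.
rewrite -lap0E; apply: cvgM; last exact: cvg_cst.
apply: cvgM; first exact: cvg_cst.
have := @cvg_comp _ _ _ (fun t : R => nu * q / t ^+ 2)
  (fun l => lap (affine_rem nu) `|l|) _ _ _
  (@cvg_sqr_invr_y (nu * q)) (cvg_lap0 (integrable_affine_rem nu12)).
apply: cvg_trans; apply: near_eq_cvg; near=> t => /=.
by rewrite ger0_norm// divr_ge0 ?mulr_ge0 ?(ltW nu0) ?sqr_ge0.
Unshelve. all: end_near. Qed.

(** Off the diagonal the correlation and its derivative vanish as the range
    parameter tends to 0, since [expR (- x)] is at most [1 / x] and [4 / x ^ 2]. *)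
Lemma lap_gw_le nu l : 0 < nu -> 0 < l -> lap (gw nu) l <= l^-1 * Gamma (nu + 1).
Proof.
move=> nu0 l0; have nu10 : 0 < nu + 1 by lra.
rewrite GammaE; apply: le_lap.
- by apply: integrable_lap; [exact: integrable_gw|move=> t; exact/ltW/gw_gt0|exact: ltW].
- exact: integrable_gw.
move=> t; rewrite (_ : gw nu t = gw (nu + 1) t * expR (- t)); last by rewrite gw_shift addrK.
rewrite [leRHS]mulrC -mulrA ler_wpM2l ?(ltW (gw_gt0 _ _))//.
rewrite [X in _ * X]expRN ler_pdivrMr ?expR_gt0// ler_pdivlMl//.
by apply: le_trans (expR_ge1Dx _); rewrite lerDr.
Qed.

Lemma lap_gw_le_sqr nu l : 1 < nu -> 0 < l ->
  lap (gw (nu - 1)) l <= 4 * l ^- 2 * Gamma (nu + 1).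
Proof.
move=> nu1 l0; have nu10 : 0 < nu + 1 by lra.
have nu0 : 0 < nu - 1 by lra.
rewrite GammaE; apply: le_lap.
- by apply: integrable_lap; [exact: integrable_gw|move=> t; exact/ltW/gw_gt0|exact: ltW].
- exact: integrable_gw.
move=> t; rewrite (_ : gw (nu - 1) t = gw (nu + 1) t * expR (- t) ^+ 2); last first.
  by rewrite /gw -expRM_natl -expRD; congr expR; ring.
rewrite [leRHS]mulrC -mulrA ler_wpM2l ?(ltW (gw_gt0 _ _))//.
move: (expR (- t)) (expR_ge0 (- t)) => x x0.
rewrite expRN ler_pdivrMr ?expR_gt0// mulrAC ler_pdivlMr ?exprn_gt0//.
have -> : expR (l * x) = expR (l * x / 2) ^+ 2.
  by rewrite -expRM_natl; congr expR; field.
have lx0 : 0 <= l * x by rewrite mulr_ge0// ltW.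
by move: (expR_ge1Dx (l * x / 2)); move: (expR _) => E; nra.
Qed.

Lemma cvg_at_right0_le (f : R -> R) C m :
  (forall t, 0 < t -> 0 <= f t <= C * t ^+ m.+1) -> f t @[t --> 0^'+] --> 0.
Proof.
move=> fC; apply: (@squeeze_cvgr _ _ _ _ (cst 0) (fun t => C * t ^+ m.+1)).
- by near=> t; apply: fC; near: t; exact: nbhs_right_gt.
- exact: cvg_cst.
- rewrite -[X in _ --> X](mulr0 C); apply: cvgM; first exact: cvg_cst.
  rewrite -[X in _ --> X](expr0n R m.+1); apply: cvg_at_right_filter.
  exact: exprn_continuous.
Unshelve. all: end_near. Qed.

Lemma cvg_kmat_0 nu q : 0 < nu -> 0 < q -> kmat nu theta q @[theta --> 0^'+] --> 0.
Proof.
move=> nu0 q0; have nq0 : 0 < nu * q by rewrite mulr_gt0.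
apply: (@cvg_at_right0_le _ ((nu * q)^-1 * Gamma (nu + 1) / Gamma nu) 1) => t t0.
have G0 := Gamma_gt0 nu0.
have l0 : 0 < nu * q / t ^+ 2 by rewrite divr_gt0// exprn_gt0.
rewrite /kmat divr_ge0 ?(ltW G0) ?lap_ge0//=; last by move=> u; exact/ltW/gw_gt0.
apply: (@le_trans _ _ ((nu * q / t ^+ 2)^-1 * Gamma (nu + 1) / Gamma nu)).
  by rewrite ler_wpM2r ?invr_ge0 ?(ltW G0)// lap_gw_le.
by rewrite invf_div; rewrite le_eqVlt; apply/orP; left; apply/eqP; ring.
Qed.

Lemma cvg_dkmat_0 nu q : 1 < nu -> 0 <= q -> dkmat nu theta q @[theta --> 0^'+] --> 0.
Proof.
move=> nu1; have nu0 : 0 < nu by lra.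
have G0 := Gamma_gt0 nu0.
rewrite le_eqVlt => /predU1P[<-|q0].
  rewrite /dkmat; under eq_fun do rewrite !(mulr0, mul0r).
  exact: cvg_cst.
have nq0 : 0 < nu * q by rewrite mulr_gt0.
(* [8 = 2 * 4], from the chain rule and from [lap_gw_le_sqr] *)
apply: (@cvg_at_right0_le _ (8 / (nu * q) * Gamma (nu + 1) / Gamma nu) 0) => t t0.
have l0 : 0 < nu * q / t ^+ 2 by rewrite divr_gt0// exprn_gt0.
have c0 : 0 <= 2 * (nu * q) / t ^+ 3.
  apply: divr_ge0; last by rewrite exprn_ge0// ltW.
  by rewrite mulr_ge0 ?(ltW nq0).
have L0 : 0 <= lap (gw (nu - 1)) (nu * q / t ^+ 2).
  by apply: lap_ge0 => u; exact/ltW/gw_gt0.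
have Lle := lap_gw_le_sqr nu1 l0.
rewrite /dkmat; move: (lap _ _) (Gamma (nu + 1)) (Gamma nu) G0 L0 Lle => L G1 G G0 L0 Lle.
have -> /= : 0 <= 2 * (nu * q) / t ^+ 3 * L / G by rewrite divr_ge0 ?(ltW G0)// mulr_ge0.
apply: (@le_trans _ _ (2 * (nu * q) / t ^+ 3 * (4 * (nu * q / t ^+ 2) ^- 2 * G1) / G)).
  by rewrite ler_wpM2r ?invr_ge0 ?(ltW G0)// ler_wpM2l.
by rewrite le_eqVlt; apply/orP; left; apply/eqP; field; rewrite !gt_eqF.
Qed.

Lemma continuous_kmat nu q theta : 0 < nu -> 0 <= q -> 0 < theta ->
  {for theta, continuous (kmat nu ^~ q)}.
Proof.
move=> nu0 q0 t0; apply/differentiable_continuous/derivable1_diffP.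
by have [] := is_derive_kmat nu0 q0 t0.
Qed.

Lemma continuous_dkmat nu q theta : 1 < nu -> 0 <= q -> 0 < theta ->
  {for theta, continuous (dkmat nu ^~ q)}.
Proof.
move=> nu1; have nu10 : 0 < nu - 1 by lra.
rewrite le_eqVlt => /predU1P[<-|q0] t0.
  rewrite (_ : dkmat nu ^~ 0 = cst 0); first exact: cst_continuous.
  by apply/funext => u; rewrite /dkmat !(mulr0, mul0r).
have nu0 : 0 < nu by lra.
have ww : lap_weight (gw (nu - 1)).
  by apply: integrable_lap_weight; [exact: integrable_gw|move=> t; exact/ltW/gw_gt0].
have cl : {for theta, continuous (fun t : R => lap (gw (nu - 1)) (nu * q / t ^+ 2))}.
  apply/differentiable_continuous/derivable1_diffP.
  by have [] := is_derive_lap_scaled ww (mulr_gt0 nu0 q0) t0.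
have ci : {for theta, continuous (fun t : R => (t ^+ 3)^-1)}.
  apply: (@continuous_comp _ _ _ (fun t : R => t ^+ 3) (fun t => t^-1)).
    exact: exprn_continuous.
  by apply: inv_continuous; rewrite expf_eq0/= gt_eqF.
suff : dkmat nu t q @[t --> theta] --> dkmat nu theta q by [].
rewrite /dkmat; apply: cvgM; last exact: cvg_cst.
by apply: cvgM; [apply: cvgM; [exact: cvg_cst|exact: ci]|exact: cl].
Qed.

End scaled_derivatives.

(** * The restricted covariance matrix *)

Section profile.
Context {R : realType} {m : nat}.

(** The likelihood integrated over the coefficients and the variance, up to a
    constant. *)
Definition profile (z : 'cV[R]_m) (M : 'M[R]_m) : R :=
  (\det M) `^ (- 2^-1) * (mxform (invmx M) z z) `^ (- (m%:R / 2)).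

Lemma profile_gt0 z M : M^T = M -> posdef M -> z != 0 -> 0 < profile z M.
Proof.
move=> Msym Mpos z0; have Q0 : 0 < mxform (invmx M) z z by exact: posdef_invmx.
by rewrite mulr_gt0 ?powR_gt0// posdef_det_gt0.
Qed.

(** The scalar factors of the determinant and of the quadratic form cancel. *)
Lemma profile_scale z M (c : R) : 0 < c -> M^T = M -> posdef M -> z != 0 ->
  profile z (c *: M) = profile z M.
Proof.
move=> c0 Msym Mpos z0; have Mu := posdef_unitmx Msym Mpos.
have d0 := posdef_det_gt0 Msym Mpos.
have Q0 : 0 < mxform (invmx M) z z by exact: posdef_invmx.
have cm0 : 0 <= c ^+ m by rewrite exprn_ge0// ltW.
have ci0 : 0 <= c^-1 by rewrite invr_ge0 ltW.
have cu : c *: M \in unitmx by rewrite unitmxZ ?unitfE ?gt_eqF.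
rewrite /profile detZ (invmxZ cu).
have -> : mxform (c^-1 *: invmx M) z z = c^-1 * mxform (invmx M) z z.
  by rewrite /mxform -scalemxAr -scalemxAl [LHS]mxE.
rewrite (powRM _ cm0 (ltW d0)) (powRM _ ci0 (ltW Q0)).
have -> : (c ^+ m) `^ (- 2^-1) = c `^ (- (m%:R / 2)).
  by rewrite -powR_mulrn ?(ltW c0)// -powRrM; congr (_ `^ _); ring.
have -> : c^-1 `^ (- (m%:R / 2)) = (c `^ (- (m%:R / 2)))^-1.
  by rewrite -powR_inv1 ?(ltW c0)// -powRrM mulN1r powRN.
by rewrite mulrACA mulfV ?mul1r// gt_eqF// powR_gt0.
Qed.

Lemma cvg_powR (T : Type) (F : set_system T) (FF : Filter F) (f : T -> R) (a l : R) :
  0 < l -> f t @[t --> F] --> l -> f t `^ a @[t --> F] --> l `^ a.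
Proof.
move=> l0 fl; apply: (@continuous_cvg _ _ _ _ _ f (@powR R ^~ a)) fl.
apply/differentiable_continuous/derivable1_diffP; apply: derivable_powR.
by rewrite in_itv/= l0.
Qed.

Lemma cvg_profile (T : Type) (F : set_system T) (FF : Filter F) z
    (M : T -> 'M[R]_m) (L : 'M[R]_m) : L^T = L -> posdef L -> z != 0 ->
  (forall a b, M t a b @[t --> F] --> L a b) ->
  profile z (M t) @[t --> F] --> profile z L.
Proof.
move=> Lsym Lpos z0 cM; have Lu := posdef_unitmx Lsym Lpos.
have Q0 : 0 < mxform (invmx L) z z by exact: posdef_invmx.
have cQ : mxform (invmx (M t)) z z @[t --> F] --> mxform (invmx L) z z.
  apply: cvg_mulmx => [a b|a b]; last exact: cvg_cst.
  apply: cvg_mulmx => c d; first exact: cvg_cst.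
  exact: cvg_invmx.
apply: cvgM; apply: cvg_powR => //; first exact: posdef_det_gt0.
exact: cvg_det.
Qed.

End profile.

Section restricted_kernels.
Context {R : realType} {n r m : nat}.
Variables (x : 'I_n -> 'rV[R]_r) (W : 'M[R]_(n, m)).
Implicit Types k : 'I_n -> 'I_n -> R.

(** The covariance of the contrasts [W^T y] under the kernel [k]. *)
Definition kernel_mx k : 'M[R]_m := W^T *m (\matrix_(i, j) k i j) *m W.

Lemma kernel_mxE k a b : kernel_mx k a b = \sum_i \sum_j W i a * W j b * k i j.
Proof.
rewrite mxE exchange_big/=; apply: eq_bigr => j _.
rewrite mxE mulr_suml; apply: eq_bigr => i _.
by rewrite !mxE; ring.
Qed.

Lemma mxform_qform (S : 'M[R]_n) v : mxform S v v = qform (fun i => v i 0) S.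
Proof.
rewrite /mxform mxE /qform exchange_big/=; apply: eq_bigr => j _.
rewrite mxE mulr_suml; apply: eq_bigr => i _.
by rewrite !mxE; ring.
Qed.

Lemma mxform_kernel_mx k c :
  mxform (kernel_mx k) c c = qform (fun i => (W *m c) i 0) k.
Proof.
rewrite -mxform_mulmx mxform_qform; apply: eq_bigr => i _.
by apply: eq_bigr => j _; rewrite mxE.
Qed.

Lemma kernel_mx_sym k : (forall i j, k i j = k j i) -> (kernel_mx k)^T = kernel_mx k.
Proof.
move=> ksym; rewrite /kernel_mx !trmx_mul trmxK mulmxA; congr (_ *m _ *m _).
by apply/matrixP => i j; rewrite !mxE.
Qed.

Lemma cvg_kernel_mx (T : Type) (F : set_system T) (FF : Filter F)
    (k : T -> 'I_n -> 'I_n -> R) (l : 'I_n -> 'I_n -> R) :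
  (forall i j, k t i j @[t --> F] --> l i j) ->
  forall a b, kernel_mx (k t) a b @[t --> F] --> kernel_mx l a b.
Proof.
move=> kl a b; rewrite kernel_mxE; under eq_fun do rewrite kernel_mxE.
apply: cvg_sumr => i _; apply: cvg_sumr => j _.
by apply: cvgM; [exact: cvg_cst|exact: kl].
Qed.

Lemma is_derive_kernel_mx (k : R -> 'I_n -> 'I_n -> R) (dk : 'I_n -> 'I_n -> R) (t : R) :
  (forall i j, is_derive t 1 (fun t => k t i j) (dk i j)) ->
  forall a b, is_derive t 1 (fun t => kernel_mx (k t) a b) (kernel_mx dk a b).
Proof.
move=> kd a b; rewrite kernel_mxE.
rewrite (_ : (fun t => _) = fun t => \sum_i \sum_j W i a * W j b * k t i j); last first.
  by apply/funext => u; rewrite kernel_mxE.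
by apply: is_derive_sumr => i; apply: is_derive_sumr => j.
Qed.

Hypothesis HW : (affine_design x)^T *m W = 0.

Lemma W_affine : W^T *m (const_mx 1 : 'cV[R]_n) = 0 /\ W^T *m (\matrix_i x i) = 0.
Proof.
have : W^T *m (affine_design x) = 0.
  by rewrite -[W^T *m _]trmxK trmx_mul trmxK HW trmx0.
rewrite /affine_design (mul_mx_row W^T (const_mx 1 : 'cV[R]_n)).
move=> /(congr1 (fun A : 'M[R]_(m, 1 + r) => (lsubmx A, rsubmx A))).
by rewrite row_mxKl row_mxKr !linear0 => -[-> ->].
Qed.

Lemma kernel_mx1 : kernel_mx (fun _ _ => 1) = 0.
Proof.
have [W1 _] := W_affine.
rewrite /kernel_mx (_ : (\matrix_(i, j) 1) = (const_mx 1 : 'cV[R]_n) *m (const_mx 1 : 'rV[R]_n)).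
  by rewrite mulmxA W1 !mul0mx.
by apply/matrixP => i j; rewrite !mxE big_ord1 !mxE mulr1.
Qed.

(** A squared distance is [|x|^2 + |y|^2 - 2 <x, y>]: each term has a factor that
    is constant or linear in one of the points, which [W] kills. *)
Lemma kernel_mx_sqdist : kernel_mx (sqdist x) = 0.
Proof.
have [W1 WX] := W_affine.
have W1' : (const_mx 1 : 'rV[R]_n) *m W = 0.
  by rewrite -[LHS]trmxK trmx_mul trmx_const W1 trmx0.
pose d : 'cV[R]_n := \col_i dotp x i i.
have -> : kernel_mx (sqdist x) = W^T *m (d *m (const_mx 1 : 'rV[R]_n) +
   (const_mx 1 : 'cV[R]_n) *m d^T - 2 *: ((\matrix_i x i) *m (\matrix_i x i)^T)) *m W.
  congr (_ *m _ *m _); apply/matrixP => i j.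
  rewrite !mxE !big_ord1 !mxE sqdistE mulr1 mul1r; congr (_ - _ * _).
  by apply: eq_bigr => k _; rewrite !mxE.
rewrite mulmxBr mulmxDr !mulmxBl !mulmxDl !mulmxA W1 !mul0mx addr0.
rewrite -scalemxAr !mulmxA WX !mul0mx scaler0 mul0mx subr0.
by rewrite -!mulmxA W1' !mulmx0.
Qed.

Lemma kernel_mx_expansion k (a b : R) :
  kernel_mx (fun i j => 1 + a * sqdist x i j + b * k i j) = b *: kernel_mx k.
Proof.
rewrite -[RHS]add0r -[in RHS](scaler0 _ a) -[in RHS]kernel_mx_sqdist -[RHS]add0r.
rewrite -[in RHS]kernel_mx1 addrA /kernel_mx.
have -> : \matrix_(i, j) (1 + a * sqdist x i j + b * k i j) =
    \matrix_(i, j) 1 + a *: \matrix_(i, j) sqdist x i j + b *: \matrix_(i, j) k i j :> 'M[R]_n.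
  by apply/matrixP => i j; rewrite !mxE.
by rewrite !mulmxDr !mulmxDl -!scalemxAr -!scalemxAl.
Qed.

End restricted_kernels.

Section reference_prior.
Context {R : realType} {n r m : nat}.
Variables (nu : R) (x : 'I_n -> 'rV[R]_r) (W : 'M[R]_(n, m)).
Hypothesis nu12 : 1 < nu < 2.
Hypothesis xinj : injective x.
Hypothesis WW : W^T *m W = 1%:M.
Hypothesis HW : (affine_design x)^T *m W = 0.
Hypothesis m0 : (0 < m)%N.

Let nu1 : 1 < nu. Proof. by case/andP: nu12. Qed.
Let nu0 : 0 < nu. Proof. by apply: lt_trans nu1. Qed.
Let q := sqdist x.
Let q0 i j : 0 <= q i j. Proof. exact: sqdist_ge0. Qed.

Let qsym i j : q i j = q j i.
Proof. by apply: eq_bigr => k _; rewrite !mxE -sqrrN opprB. Qed.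

Lemma SigmaE theta i j : 0 < theta -> Sigma nu x theta i j = kmat nu theta (q i j).
Proof.
move=> t0; have h : 0 <= norm2 (x i - x j) / theta.
  by apply: divr_ge0; [exact: sqrtr_ge0|exact: ltW].
by rewrite mxE (maternE nu0 h) exprMn norm2_sqdist exprVn mulrA.
Qed.

Lemma SigmaWE theta : 0 < theta ->
  SigmaW nu x W theta = kernel_mx W (fun i j => kmat nu theta (q i j)).
Proof.
move=> t0; congr (_ *m _ *m _); apply/matrixP => i j.
by rewrite (SigmaE _ _ t0) mxE.
Qed.

(** The covariance of the contrasts without the scalar factor
    [theta `^ (- 2 nu)] carrying its decay. *)
Definition rescaled_SigmaW theta : 'M[R]_m := kernel_mx W (fun i j => rmat nu theta (q i j)).

Definition limit_SigmaW : 'M[R]_m := kernel_mx W (fun i j =>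
  (nu * q i j) `^ nu * (\int[lebesgue_measure]_t affine_rem nu t) / Gamma nu).

Lemma SigmaW_rescaled theta : 0 < theta ->
  SigmaW nu x W theta = theta `^ (- (2 * nu)) *: rescaled_SigmaW theta.
Proof.
move=> t0; rewrite SigmaWE// -(kernel_mx_expansion HW _ (- (nu * Gamma (nu - 1) / Gamma nu / theta ^+ 2))).
congr (_ *m _ *m _); apply/matrixP => i j.
by rewrite !mxE kmat_expansion.
Qed.

Lemma W_neq0 (c : 'cV[R]_m) : c != 0 -> exists i, (W *m c) i 0 != 0.
Proof.
move=> c0; apply/cV0Pn; apply: contra_neq c0 => e.
by rewrite -[c]mul1mx -WW -mulmxA e mulmx0.
Qed.

Lemma Sigma_sym theta : (Sigma nu x theta)^T = Sigma nu x theta.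
Proof.
apply/matrixP => i j; rewrite !mxE; congr (matern _ (_ / _)).
by congr Num.sqrt; exact: qsym.
Qed.

Lemma Sigma_posdef theta : 0 < theta -> posdef (Sigma nu x theta).
Proof.
move=> t0 v v0; have /cV0Pn[i vi] := v0.
have GN : Gamma nu != 0 by rewrite gt_eqF// Gamma_gt0.
rewrite mxform_qform -(pmulr_lgt0 _ (Gamma_gt0 nu0)).
have -> : qform (fun i => v i 0) (Sigma nu x theta) * Gamma nu =
    qform (fun i => v i 0) (fun i j => lap (gw nu) (nu / theta ^+ 2 * q i j)).
  rewrite /qform mulr_suml; apply: eq_bigr => a _; rewrite mulr_suml.
  apply: eq_bigr => b _; rewrite (SigmaE _ _ t0) /kmat -mulrA (divfK GN).
  by rewrite (mulrAC nu).
by apply: qform_lap_gt0 => //; [rewrite divr_gt0// exprn_gt0|exists i].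
Qed.

Lemma SigmaW_sym theta : (SigmaW nu x W theta)^T = SigmaW nu x W theta.
Proof. by rewrite /SigmaW !trmx_mul trmxK Sigma_sym mulmxA. Qed.

Lemma SigmaW_posdef theta : 0 < theta -> posdef (SigmaW nu x W theta).
Proof.
move=> t0; apply: posdef_inj; first exact: Sigma_posdef.
by move=> c e; rewrite -[c]mul1mx -WW -mulmxA e mulmx0.
Qed.

Lemma limit_SigmaW_sym : limit_SigmaW^T = limit_SigmaW.
Proof. by apply: kernel_mx_sym => i j; rewrite qsym. Qed.

(** The contrasts [W *m c] are orthogonal to affine functions, as is needed for
    [qform_powR_gt0]. *)
Lemma limit_SigmaW_posdef : posdef limit_SigmaW.
Proof.
move=> c c0; rewrite mxform_kernel_mx; set v := fun i => _.
pose K := nu `^ nu * (\int[lebesgue_measure]_t affine_rem nu t) / Gamma nu.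
have K0 : 0 < K.
  by rewrite divr_gt0 ?Gamma_gt0// mulr_gt0 ?powR_gt0// integral_affine_rem_gt0.
have -> : qform v (fun i j => (nu * q i j) `^ nu *
    (\int[lebesgue_measure]_t affine_rem nu t) / Gamma nu) =
    K * qform v (fun i j => q i j `^ nu).
  rewrite /qform mulr_sumr; apply: eq_bigr => i _; rewrite mulr_sumr.
  by apply: eq_bigr => j _; rewrite powRM ?(ltW nu0)// /K; ring.
rewrite mulr_gt0//; apply: qform_powR_gt0 => //.
- exact: W_neq0.
- by rewrite -(mxform_kernel_mx W (fun _ _ => 1)) (kernel_mx1 HW) /mxform mulmx0 mul0mx mxE.
- by rewrite -(mxform_kernel_mx W) (kernel_mx_sqdist HW) /mxform mulmx0 mul0mx mxE.
Qed.

Lemma cvg_rescaled_SigmaW a b :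
  rescaled_SigmaW theta a b @[theta --> +oo] --> limit_SigmaW a b.
Proof. by apply: cvg_kernel_mx => i j; exact: cvg_rmat. Qed.

Lemma rescaled_SigmaW_unitmx theta : 0 < theta -> rescaled_SigmaW theta \in unitmx.
Proof.
move=> t0; have := posdef_unitmx (SigmaW_sym theta) (SigmaW_posdef t0).
by rewrite SigmaW_rescaled// unitmxZ// unitfE gt_eqF// powR_gt0.
Qed.

Lemma is_derive_SigmaW (theta : R) a b : 0 < theta ->
  is_derive theta 1 (fun t => SigmaW nu x W t a b)
    (kernel_mx W (fun i j => dkmat nu theta (q i j)) a b).
Proof.
move=> t0; have : is_derive theta 1 (fun t => kernel_mx W (fun i j => kmat nu t (q i j)) a b)
    (kernel_mx W (fun i j => dkmat nu theta (q i j)) a b).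
  by apply: is_derive_kernel_mx => i j; exact: is_derive_kmat.
apply: near_eq_is_derive; near=> t; rewrite SigmaWE//.
by near: t; exact: lt_nbhsr.
Unshelve. all: end_near. Qed.

Lemma derive1_SigmaW (theta : R) : 0 < theta ->
  derive1 (SigmaW nu x W) theta = kernel_mx W (fun i j => dkmat nu theta (q i j)).
Proof.
move=> t0; rewrite derive1E derive_mx; last first.
  by apply/derivable_mxP => a b; have [] := is_derive_SigmaW a b t0.
by apply/matrixP => a b; rewrite mxE; have [_ ->] := is_derive_SigmaW a b t0.
Qed.

(** The product rule, in the form required by [prior_of_scale]. *)
Lemma derive1_SigmaW_rescaled (theta : R) : 0 < theta ->
  derive1 (SigmaW nu x W) theta =
  (- (2 * nu) / theta) *: (theta `^ (- (2 * nu)) *: rescaled_SigmaW theta) +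
  theta `^ (- (2 * nu)) *: kernel_mx W (fun i j => drmat nu theta (q i j)).
Proof.
move=> t0; rewrite derive1_SigmaW//; apply/matrixP => a b.
pose p := - (2 * nu); rewrite -/p.
have [_ <-] := is_derive_SigmaW a b t0.
have dF : is_derive theta 1 (fun t => rescaled_SigmaW t a b)
    (kernel_mx W (fun i j => drmat nu theta (q i j)) a b).
  by apply: is_derive_kernel_mx => i j; exact: is_derive_rmat.
have dP : is_derive theta 1 (fun t : R => t `^ p) (p / theta * theta `^ p).
  have tI : theta \in `]0, +oo[ by rewrite in_itv/= t0.
  apply: DeriveDef; first exact: derivable_powR.
  rewrite -derive1E powR_derive1// powRD ?(gt_eqF t0) ?implybT//.
  by rewrite powR_inv1 ?ltW//; ring.
have := is_deriveM dP dF.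
set f := (_ * _ : R -> R); set df := _ + _ => dPF.
have [_ ->] : is_derive theta 1 (fun t => SigmaW nu x W t a b) df.
  apply: near_eq_is_derive dPF; near=> t.
  rewrite SigmaW_rescaled; first by rewrite [RHS]mxE.
  by near: t; exact: lt_nbhsr.
rewrite [RHS]mxE /df [RHS]addrC; congr (_ + _); first by rewrite [RHS]mxE.
by rewrite [RHS]mxE [X in _ = _ * X]mxE /GRing.scale/=; ring.
Unshelve. all: end_near. Qed.

Lemma reference_prior_rescaled (theta : R) : 0 < theta ->
  reference_prior nu x W theta =
  prior_of (kernel_mx W (fun i j => drmat nu theta (q i j))) (rescaled_SigmaW theta).
Proof.
move=> t0; rewrite -(@prior_of_scale _ _ _ _ (- (2 * nu) / theta) (theta `^ (- (2 * nu)))) //.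
- by rewrite -derive1_SigmaW_rescaled// -SigmaW_rescaled.
- exact: rescaled_SigmaW_unitmx.
- by rewrite gt_eqF// powR_gt0.
Qed.

(** A common constant for all entries: the sum of the constants for the pairs of
    design points, weighted by the coefficients of [W]. *)
Lemma kernel_mx_drmat_le : exists2 C, 0 <= C & forall theta a b, 0 < theta ->
  `|kernel_mx W (fun i j => drmat nu theta (q i j)) a b| <= C * theta `^ (- 2 * (2 - nu) - 1).
Proof.
pose C i j := sval (cid2 (drmat_le nu12 (q0 i j))).
have C0 i j : 0 <= C i j by rewrite /C; case: cid2.
have CP i j theta : 0 < theta ->
    `|drmat nu theta (q i j)| <= C i j * theta `^ (- 2 * (2 - nu) - 1).
  by rewrite /C; case: cid2 => /= c _; apply.
pose K a b := \sum_i \sum_j `|W i a * W j b| * C i j.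
have K0 a b : 0 <= K a b.
  by apply: sumr_ge0 => i _; apply: sumr_ge0 => j _; rewrite mulr_ge0.
exists (\sum_a \sum_b K a b).
  by apply: sumr_ge0 => a _; apply: sumr_ge0 => b _.
move=> theta a b t0; apply: (@le_trans _ _ (K a b * theta `^ (- 2 * (2 - nu) - 1))).
  rewrite kernel_mxE mulr_suml; apply: (le_trans (ler_norm_sum _ _ _)).
  apply: ler_sum => i _; rewrite mulr_suml; apply: (le_trans (ler_norm_sum _ _ _)).
  by apply: ler_sum => j _; rewrite normrM -mulrA ler_wpM2l// CP.
rewrite ler_wpM2r ?powR_ge0// (bigD1 a)//= (bigD1 b)//= -addrA lerDl.
rewrite addr_ge0//; apply: sumr_ge0 => // i _.
by apply: sumr_ge0 => j _.
Qed.

Lemma reference_prior_le : exists2 C, 0 < C &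
  \forall theta \near +oo, `|reference_prior nu x W theta| <= C * theta `^ (- 2 * (2 - nu) - 1).
Proof.
have [C C0 CP] := kernel_mx_drmat_le.
have Lu := posdef_unitmx limit_SigmaW_sym limit_SigmaW_posdef.
pose N := invmx limit_SigmaW.
have cN : forall a b, (invmx (rescaled_SigmaW theta)) a b @[theta --> +oo] --> N a b.
  by apply: cvg_invmx => //; exact: cvg_rescaled_SigmaW.
pose K := \sum_a \sum_b (`|N a b| + 1).
have K0 : 0 <= K by apply: sumr_ge0 => a _; apply: sumr_ge0 => b _; rewrite addr_ge0.
have NK a b : `|N a b| + 1 <= K.
  rewrite /K (bigD1 a)//= (bigD1 b)//= -addrA lerDl addr_ge0//; apply: sumr_ge0 => // i _.
  by apply: sumr_ge0 => j _; rewrite addr_ge0.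
exists (m%:R * (m%:R * (C * K)) + 1); first by rewrite ltr_wpDl// !mulr_ge0.
have nearK : \forall theta \near +oo, forall ab : 'I_m * 'I_m,
    `|(invmx (rescaled_SigmaW theta)) ab.1 ab.2| <= K.
  apply: filter_forall => -[a b] /=.
  have : `|N a b| < `|N a b| + 1 by rewrite ltrDl.
  move=> /(cvgr_norm_lt _ (cN a b)); apply: filterS => t /ltW /le_trans; apply.
  exact: NK.
near=> theta.
have t0 : 0 < theta by near: theta; exact: nbhs_pinfty_gt.
have tK : forall ab : 'I_m * 'I_m, `|(invmx (rescaled_SigmaW theta)) ab.1 ab.2| <= K.
  by near: theta.
rewrite reference_prior_rescaled// ger0_norm ?prior_of_ge0//.
set rho := theta `^ _; have rho0 : 0 <= rho by exact: powR_ge0.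
apply: (@le_trans _ _ (m%:R * (m%:R * (C * rho * K)))).
  apply: prior_of_le => //; first by rewrite mulr_ge0.
    by move=> a b; exact: CP.
  by move=> a b; exact: (tK (a, b)).
rewrite (_ : m%:R * (m%:R * (C * rho * K)) = m%:R * (m%:R * (C * K)) * rho); last by ring.
by rewrite ler_wpM2r// lerDl.
Unshelve. all: end_near. Qed.

(** Away from infinity the correlation itself, without rescaling, is the
    convenient kernel. *)
Lemma reference_prior_kernel (theta : R) : 0 < theta ->
  reference_prior nu x W theta =
  prior_of (kernel_mx W (fun i j => dkmat nu theta (q i j)))
    (kernel_mx W (fun i j => kmat nu theta (q i j))).
Proof. by move=> t0; rewrite -derive1_SigmaW// -SigmaWE. Qed.

Lemma continuous_reference_prior : {in `]0, +oo[, continuous (reference_prior nu x W)}.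
Proof.
move=> t; rewrite in_itv/= andbT => t0; rewrite /continuous_at reference_prior_kernel//.
have : prior_of (kernel_mx W (fun i j => dkmat nu u (q i j)))
    (kernel_mx W (fun i j => kmat nu u (q i j))) @[u --> t] -->
  prior_of (kernel_mx W (fun i j => dkmat nu t (q i j)))
    (kernel_mx W (fun i j => kmat nu t (q i j))).
  apply: cvg_prior_of.
  - by rewrite -SigmaWE//; exact: posdef_unitmx (SigmaW_sym _) (SigmaW_posdef t0).
  - by apply: cvg_kernel_mx => i j; exact: continuous_dkmat.
  - by apply: cvg_kernel_mx => i j; exact: continuous_kmat.
apply: cvg_trans; apply: near_eq_cvg; near=> u; rewrite reference_prior_kernel//.
by near: u; exact: lt_nbhsr.
Unshelve. all: end_near. Qed.

(** At 0 the covariance of the contrasts tends to [W^T *m W = 1] and its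
    derivative to 0. *)
Lemma cvg_reference_prior_0 : exists l : R, reference_prior nu x W theta @[theta --> 0^'+] --> l.
Proof.
pose delta (i j : 'I_n) : R := (i == j)%:R.
exists (prior_of (kernel_mx W (fun _ _ => 0)) (kernel_mx W delta)).
have deltaE : kernel_mx W delta = 1%:M.
  rewrite /kernel_mx (_ : \matrix_(i, j) delta i j = 1%:M) ?mulmx1//.
  by apply/matrixP => i j; rewrite !mxE.
have : prior_of (kernel_mx W (fun i j => dkmat nu u (q i j)))
    (kernel_mx W (fun i j => kmat nu u (q i j))) @[u --> 0^'+] -->
    prior_of (kernel_mx W (fun _ _ => 0)) (kernel_mx W delta).
  apply: cvg_prior_of; first by rewrite deltaE unitmx1.
  - by apply: cvg_kernel_mx => i j; exact: cvg_dkmat_0.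
  - apply: cvg_kernel_mx => i j; rewrite /delta; case: eqVneq => [->|ij].
      rewrite /q sqdistxx; under eq_fun do rewrite /kmat mulr0 mul0r lap0E -GammaE divff ?gt_eqF ?Gamma_gt0//.
      exact: cvg_cst.
    by apply: cvg_kmat_0 => //; exact: sqdist_gt0.
apply: cvg_trans; apply: near_eq_cvg; by near=> u; rewrite reference_prior_kernel.
Unshelve. all: end_near. Qed.

Lemma integrable_reference_prior :
  lebesgue_measure.-integrable `]0%R, +oo[ (EFin \o reference_prior nu x W).
Proof.
have [C C0 CP] := reference_prior_le.
have [l cl] := cvg_reference_prior_0.
apply: (@integrable_half_line _ _ (2 * (2 - nu) + 1) C l) => //.
- by case/andP: nu12 => *; lra.
- exact: continuous_reference_prior.
- apply: filterS CP => t; rewrite (_ : - 2 * (2 - nu) - 1 = - (2 * (2 - nu) + 1))//.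
  by ring.
Qed.

Hypothesis nE : n = (r.+1 + m)%N.
Hypothesis rkH : \rank (affine_design x) = r.+1.

Lemma cvg_likelihood (y : 'cV[R]_n) : W^T *m y != 0 ->
  exists2 l : R, l != 0 &
    likelihood nu x (affine_design x) y theta @[theta --> +oo] --> l%:E.
Proof.
move=> z0; have [k [k0 kE]] := integrated_likelihood_closed nE m0 rkH HW WW.
have Lsym := limit_SigmaW_sym; have Lpos := limit_SigmaW_posdef.
exists (k * profile (W^T *m y) limit_SigmaW).
  by rewrite gt_eqF// mulr_gt0// profile_gt0.
have likE theta : 0 < theta -> likelihood nu x (affine_design x) y theta =
    (k * profile (W^T *m y) (rescaled_SigmaW theta))%:E.
  move=> t0; rewrite /likelihood (kE _ _ (Sigma_sym theta) (Sigma_posdef t0) z0).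
  rewrite -/(SigmaW nu x W theta) -/(profile _ _) (SigmaW_rescaled t0).
  rewrite (profile_scale (powR_gt0 _ t0) _ _ z0) //.
    by apply: kernel_mx_sym => i j; rewrite qsym.
  move=> v v0; have := SigmaW_posdef t0 v0; rewrite (SigmaW_rescaled t0).
  rewrite {1}/mxform -scalemxAr -scalemxAl mxE -/(mxform _ _ _).
  by rewrite pmulr_rgt0// powR_gt0.
have : (k * profile (W^T *m y) (rescaled_SigmaW theta))%:E @[theta --> +oo] -->
    (k * profile (W^T *m y) limit_SigmaW)%:E.
  apply: cvg_EFin; first exact: nearW.
  apply: cvgM; first exact: cvg_cst.
  by apply: cvg_profile => //; exact: cvg_rescaled_SigmaW.
by apply: cvg_trans; apply: near_eq_cvg; near=> theta; rewrite likE.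
Unshelve. all: end_near. Qed.

End reference_prior.

(** * The theorem *)

Theorem propositionB1 (R : realType) (r n : nat) (nu : R)
    (x : 'I_n -> 'rV[R]_r) (W : 'M[R]_(n, n - r.+1)) :
  (1 <= r)%N -> (r.+1 < n)%N ->
  1 < nu < 2 ->
  injective x ->
  \rank (affine_design x) = r.+1 ->
  W^T *m W = 1%:M ->
  (affine_design x)^T *m W = 0 ->
  [/\ (reference_prior nu x W : R -> R^o)
        =O_ (+oo_R) ((fun theta => theta `^ (- 2 * (2 - nu) - 1)) : R -> R^o),
      lebesgue_measure.-integrable `]0%R, +oo[
        (EFin \o reference_prior nu x W)
    & forall y : 'cV[R]_n, W^T *m y != 0 ->
        exists2 l : R, l != 0 &
          likelihood nu x (affine_design x) y theta @[theta --> +oo] --> l%:E].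
Proof.
move=> _ rn nu12 xinj rkH WW HW.
have m0 : (0 < n - r.+1)%N by rewrite subn_gt0.
have nE : n = (r.+1 + (n - r.+1))%N by rewrite subnKC// ltnW.
split.
- have [C C0 CP] := reference_prior_le nu12 xinj WW HW m0.
  apply/eqO_exP; exists C => //; apply: filterS CP => theta /le_trans; apply.
  by rewrite ler_wpM2l ?(ltW C0)// ler_norm.
- exact: integrable_reference_prior.
- by move=> y; exact: cvg_likelihood.
Qed.
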